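(* Let $n \ge 4$ and let $A_1, A_2, \ldots, A_n$ be positive real numbers with $A_i \ge A_{i+1}$ for all $1 \le i \le n-1$. Then there is a closed convex polyhedron $P$ in $\mathbb{R}^3$ with these $A_i$ as its face areas (that is, $P$ has exactly $n$ faces $F_1,\ldots,F_n$, with $F_i$ of area $A_i$ for each $i$) if and only if $$A_1 \le \sum_{i=2}^{n} A_i .$$ Here, in the case of equality $A_1 = \sum_{i=2}^{n} A_i$, the polyhedron $P$ is permitted to be flat, i.e., its faces tessellate and doubly cover a planar convex polygon.
   Context: A (non-flat) closed convex polyhedron in $\mathbb{R}^3$ is a bounded convex polytope with nonempty interior; its faces are its two-dimensional faces (facets), so distinct faces are not coplanar and have distinct outward unit normals. Face areas are counted with multiplicity. A flat polyhedron with faces $F_1,\ldots,F_n$ is a doubly covered planar convex polygon: there is a planar convex polygon $Q$ with nonempty interior in its plane, regarded as having two sides (two copies of $Q$), and each $F_i$ is a convex polygon assigned to one of the two sides, such that the faces assigned to each side tessellate $Q$ (their union is $Q$ and their interiors are pairwise disjoint). In a flat polyhedron several faces may therefore lie on the same side of $Q$. Flat polyhedra are allowed only when $A_1 = \sum_{i=2}^{n} A_i$; when $A_1 \ne \sum_{i=2}^{n} A_i$, ''closed convex polyhedron'' means a non-flat one. *)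

(* Defs.v *)
From mathcomp Require Export all_boot all_order all_algebra.
From mathcomp Require Export all_classical all_reals all_analysis.
Export numFieldNormedType.Exports.
Export Order.TTheory GRing.Theory Num.Theory.

Set Implicit Arguments.
Unset Strict Implicit.
Unset Printing Implicit Defensive.

Global Open Scope classical_set_scope.
Global Open Scope ring_scope.

Definition dot (R : realType) (u v : 'rV[R]_3) : R := \sum_(i < 3) u 0 i * v 0 i.

Definition plane (R : realType) (u : 'rV[R]_3) (b : R) : set 'rV[R]_3 :=
  [set x | dot u x = b].

(* A null normal [a i] gives the whole space or the empty set, so allowing it
   adds no new polytope. *)
Definition convex_polytope (R : realType) (P : set 'rV[R]_3) : Prop :=
  bounded_set P /\
  exists (m : nat) (a : 'I_m -> 'rV[R]_3) (b : 'I_m -> R),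
    P = [set x | forall i, dot (a i) x <= b i].

(* [V] is the direction of the affine hull of [F]: the least linear subspace
   containing all differences of points of [F]. *)
Definition has_affine_dim (R : realType) (F : set 'rV[R]_3) (d : nat) : Prop :=
  F !=set0 /\
  exists V : {vspace 'rV[R]_3},
    \dim V = d /\
    forall W : {vspace 'rV[R]_3},
      (V <= W)%VS <-> (forall x y, F x -> F y -> x - y \in W).

Definition facet (R : realType) (P F : set 'rV[R]_3) : Prop :=
  (exists u : 'rV[R]_3,
     u != 0 /\ F = [set x | P x /\ forall y, P y -> dot u y <= dot u x]) /\
  has_affine_dim F 2.

(* The faces are listed without repetition, so [P] has exactly [n] faces. *)
Definition nonflat_polyhedron (R : realType) (n : nat)
    (F : 'I_n -> set 'rV[R]_3) : Prop :=
  exists P : set 'rV[R]_3,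
    [/\ convex_polytope P, P° !=set0, injective F &
        forall G, facet P G <-> exists i, G = F i].

(* Interior of [F] in the subspace topology of [E]. *)
Definition interior_in (R : realType) (E F : set 'rV[R]_3) : set 'rV[R]_3 :=
  [set x | E x /\ within E (nbhs x) F].

Definition convex_polygon_in (R : realType) (E Q : set 'rV[R]_3) : Prop :=
  [/\ convex_polytope Q, Q `<=` E & interior_in E Q !=set0].

(* [side i] tells which of the two copies of [Q] the face [F i] lies on; the
   faces on either side tessellate [Q]. *)
Definition flat_polyhedron (R : realType) (n : nat)
    (F : 'I_n -> set 'rV[R]_3) : Prop :=
  exists (u : 'rV[R]_3) (b : R) (Q : set 'rV[R]_3) (side : 'I_n -> bool),
    [/\ u != 0,
        convex_polygon_in (plane u b) Q,
        forall i, convex_polygon_in (plane u b) (F i),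
        forall s : bool, \bigcup_(i in [set i | side i = s]) F i = Q &
        forall i j, i != j -> side i = side j ->
          interior_in (plane u b) (F i) `&` interior_in (plane u b) (F j)
            = set0].

(* Planar Lebesgue measure in Cartesian coordinates of a plane containing [F];
   by invariance under isometries the value does not depend on the frame
   [(o, e1, e2)]. *)
Definition has_area (R : realType) (F : set 'rV[R]_3) (a : R) : Prop :=
  exists o e1 e2 : 'rV[R]_3,
    [/\ dot e1 e1 = 1, dot e2 e2 = 1, dot e1 e2 = 0,
        F `<=` [set o + p.1 *: e1 + p.2 *: e2 | p in [set: R * R]] &
        (@lebesgue_measure R \x @lebesgue_measure R)%E
          [set p | F (o + p.1 *: e1 + p.2 *: e2)] = a%:E].

(* Main.v *)
Require Import Defs.
From mathcomp Require Import ring lra zify measurable_realfun.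

(** Necessity: project the other faces orthogonally onto the plane of [F_1].
    A ray leaving [F_1] inwards exits the polytope through another face, so the
    shadows of the other faces cover [F_1] up to the shadows of faces of
    dimension at most one, which are null; and a shadow is no larger than the
    face casting it.

    Sufficiency: in the case of equality, cut a rectangle into strips.
    Otherwise no existence theorem of Minkowski type is needed, because wedges
    [{(x, y, z) | - ga x <= z <= al x}] cut by vertical half-planes can be
    computed explicitly.  The two slanted faces (caps) get the areas [A_1, A_2],
    the vertical faces (sides) get [A_3, ..., A_n].  If the sides have normals
    [(kap_k, s_k, 0)] then the area of a side over an edge of the base is [c]
    times the integral of [x] along this edge, where [c = al + ga]; hence the
    squares of the [x]-coordinates of the vertices of the base are the partial
    sums of [- 2 A_k s_k / c].  The base closes up as soon as
    [\sum_k A_k s_k = 0], its area is [t / c] with [t = \sum_k A_k kap_k], and the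
    caps can be tilted so as to have areas [A_1] and [A_2] if and only if [A_1],
    [A_2] and [t] are the sides of a nondegenerate triangle.  The [s_k] are
    chosen as difference quotients of the convex even function
    [x |-> sqrt (r^2 x^2 + (1 - r)^2)], centred so that their weighted sum
    telescopes to [0]; as [r] runs from [0] to [1], [t] varies continuously
    from [\sum_k A_k] to a value at most one of the [A_k]. *)

Set Implicit Arguments.
Unset Strict Implicit.
Unset Printing Implicit Defensive.

Local Notation R2 R := (measurableTypeR R * measurableTypeR R)%type.
Local Notation leb2 R := (@lebesgue_measure R \x @lebesgue_measure R)%E.

(** * Planar Lebesgue measure *)

Lemma measurable_affine1 (R : realType) (a b : R) :
  measurable_fun [set: measurableTypeR R] (fun x : measurableTypeR R => a * x +
    b : measurableTypeR R).
Proof.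
by apply: measurable_funD => //; apply: measurable_funM.
Qed.

(** Uniqueness of Lebesgue measure: the pushforward scaled by [|a|] gives half-open intervals their
    length. For [a < 0] the preimage of such an interval is closed at the other end. *)
Lemma lebesgue_measure_affine (R : realType) (a b : R) (X : set (measurableTypeR R)) :
  a != 0 -> measurable X ->
  (lebesgue_measure X =
   `|a|%:E * lebesgue_measure ((fun x : measurableTypeR R => (a * x + b)%R) @^-1` X))%E.
Proof.
move=> a0 mX.
have mf := measurable_affine1 a b.
have ha : 0 <= `|a| by [].
pose nu := measure_function_pushforward__canonical__measure_function_Measure
  (@lebesgue_measure R) mf.
have -> : (`|a|%:E * lebesgue_measure ((fun x : measurableTypeR R => (a * x +
  b)%R) @^-1` X))%E
  = mscale (NngNum ha) nu X by [].
apply: lebesgue_measure_unique => // _ [[x y] /= _ <-].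
rewrite /mscale /= /pushforward.
rewrite -set_interval.set_itvoc.
have -> : (fun x0 => a * x0 + b) @^-1` `]x, y] =
  [set` (if 0 < a then `](x - b) / a, (y - b) / a] else `[(y - b) / a,
    (x - b) / a[ : interval R)].
  apply/seteqP; split => z /=; case: ltrP => ha'; rewrite !in_itv /=.
  - by rewrite ltr_pdivrMr // ler_pdivlMr // ltrBlDr lerBrDr mulrC.
  - have ha2 : a < 0 by rewrite lt_neqAle a0.
    by rewrite ltr_ndivlMr // ler_ndivrMr // ltrBlDr lerBrDr mulrC andbC.
  - by rewrite ltr_pdivrMr // ler_pdivlMr // ltrBlDr lerBrDr mulrC.
  - have ha2 : a < 0 by rewrite lt_neqAle a0.
    by rewrite ltr_ndivlMr // ler_ndivrMr // ltrBlDr lerBrDr mulrC andbC.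
rewrite lebesgue_measure_itv /= lebesgue_measure_itv.
case: ltrP => ha'; rewrite /= !lte_fin.
- rewrite ltr_pM2r ?invr_gt0 // ltrD2r; case: ifP => _; last by rewrite mule0.
  rewrite -!EFinD -EFinM; congr EFin; rewrite gtr0_norm //; field.
  by rewrite gt_eqF.
- have ha2 : a < 0 by rewrite lt_neqAle a0.
  rewrite ltr_nM2r ?invr_lt0 // ltrD2r; case: ifP => _; last by rewrite mule0.
  rewrite -!EFinD -EFinM; congr EFin; rewrite ltr0_norm //; field.
  by rewrite lt_eqF.
Qed.

Lemma measurable_affine2 (R : realType) (a b c : R) :
  measurable_fun [set: R2 R] (fun p : R2 R => a * p.1 + b * p.2 + c : measurableTypeR R).
Proof.
apply: measurable_funD => //; apply: measurable_funD; apply: measurable_funM => //.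
Qed.

Lemma measurable_affine_map (R : realType) (a b c a' b' c' : R) :
  measurable_fun [set: R2 R] (fun p : R2 R =>
    (a * p.1 + b * p.2 + c, a' * p.1 + b' * p.2 + c') : R2 R).
Proof. by apply: measurable_fun_pair; exact: measurable_affine2. Qed.

Lemma measurable_affine_preimage (R : realType) (a b c a' b' c' : R) (X : set (R2 R)) :
  measurable X -> measurable ((fun p : R2 R =>
    (a * p.1 + b * p.2 + c, a' * p.1 + b' * p.2 + c') : R2 R) @^-1` X).
Proof.
by move=> mX; rewrite -[X in measurable X]setTI; exact: measurable_affine_map.
Qed.

(** [leb2] is built from vertical sections; uniqueness of the product measure allows horizontal
    ones. *)
Lemma leb2_swap (R : realType) (X : set (R2 R)) : measurable X ->
  leb2 R X = (\int[lebesgue_measure]_y lebesgue_measure (ysection X y))%E.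
Proof.
move=> mX.
pose mu := (@lebesgue_measure R \x^ @lebesgue_measure R)%E.
transitivity (mu X); last by [].
by apply: product_measure_unique => // A B mA mB; exact: product_measure2E.
Qed.

Lemma leb2_shear2 (R : realType) (c d e : R) (X : set (R2 R)) : d != 0 ->
  measurable X -> leb2 R X =
  (`|d|%:E * leb2 R ((fun p : R2 R => (1%R * p.1 + 0%R * p.2 + 0%R,
    c * p.1 + d * p.2 + e)%R : R2 R) @^-1` X))%E.
Proof.
move=> d0 mX; have mY := measurable_affine_preimage 1 0 0 c d e mX.
rewrite /product_measure1 -ge0_integralZl //; last exact: measurable_fun_xsection.
apply: eq_integral => x _ /=.
rewrite (lebesgue_measure_affine (c * x + e) d0) /=; last exact: measurable_xsection.
congr (_ * lebesgue_measure _)%E; apply/seteqP.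
by split => y; rewrite /= /xsection /= !inE /= mul0r mul1r !addr0 [c * x + _ +
  _]addrAC [c * x + e + _]addrC ?addrA.
Qed.

Lemma leb2_shear1 (R : realType) (a b e : R) (X : set (R2 R)) : a != 0 ->
  measurable X -> leb2 R X =
  (`|a|%:E * leb2 R ((fun p : R2 R => (a * p.1 + b * p.2 + e,
    0%R * p.1 + 1%R * p.2 + 0%R)%R : R2 R) @^-1` X))%E.
Proof.
move=> d0 mX; have mY := measurable_affine_preimage a b e 0 1 0 mX.
rewrite leb2_swap // leb2_swap // -ge0_integralZl //; last exact: measurable_fun_ysection.
apply: eq_integral => y _ /=.
rewrite (lebesgue_measure_affine (b * y + e) d0) /=; last exact: measurable_ysection.
congr (_ * lebesgue_measure _)%E; apply/seteqP.
by split => x; rewrite /= /ysection /= !inE /= mul0r mul1r !addr0 ?add0r ?addrA.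
Qed.

(** When [b'] is nonzero the map is a product of the two shears. Otherwise substituting [p.1 + p.2]
    for [p.1], which preserves area, leads back to that case. *)
Lemma leb2_affine (R : realType) (a b e a' b' e' : R) (X : set (R2 R)) :
  a * b' - b * a' != 0 -> measurable X -> leb2 R X =
  (`|a * b' - b * a'|%:E * leb2 R ((fun p : R2 R => (a * p.1 + b * p.2 + e,
    a' * p.1 + b' * p.2 + e')%R : R2 R) @^-1` X))%E.
Proof.
suff key (a1 b1 e1 a1' b1' e1' : R) (Y : set (R2 R)) : b1' != 0 ->
    a1 * b1' - b1 * a1' != 0 -> measurable Y -> leb2 R Y =
  (`|a1 * b1' - b1 * a1'|%:E * leb2 R ((fun p : R2 R => (a1 * p.1 + b1 * p.2 + e1,
    a1' * p.1 + b1' * p.2 + e1')%R : R2 R) @^-1` Y))%E.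
  have [b'0|] := eqVneq b' 0; last exact: key.
  move=> D0 mX; have a'0 : a' != 0.
    by apply: contraNneq D0 => ->; rewrite b'0 !mulr0 subr0.
  have D1 : a * a' - (a + b) * a' != 0.
    by move: D0; rewrite b'0 mulr0 sub0r; congr (_ != 0); ring.
  rewrite (key a (a + b) e a' a' e' X a'0 D1 mX).
  have mY := measurable_affine_preimage a b e a' b' e' mX.
  rewrite [in RHS](leb2_shear1 1 0 (oner_neq0 R) mY) normr1 mul1e.
  congr (`|_|%:E * leb2 R _)%E; first by rewrite b'0; ring.
  apply/seteqP; split => p /=; rewrite b'0; set u := (X in X _); set v := (X in _ -> X _);
   by congr (X (_, _)); ring.
move=> b0 D0 mY.
(* [a2] is the coefficient of [p.1] once the first image coordinate is expressed through [p.1] and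
   the second image coordinate. *)
pose a2 := (a1 * b1' - b1 * a1') / b1'.
have a20 : a2 != 0 by rewrite mulf_neq0 // invr_eq0.
rewrite (leb2_shear1 (b1 / b1') (e1 - b1 * e1' / b1') a20 mY).
have mZ := measurable_affine_preimage a2 (b1 / b1') (e1 - b1 * e1' / b1') 0 1 0 mY.
rewrite (leb2_shear2 a1' e1' b0 mZ) muleA -EFinM -normrM /a2 divfK //.
congr (_ * leb2 R _)%E.
apply/seteqP; split => p /=; set u := (X in Y X); set v := (X in _ -> Y X);
  (have -> : u = v by congr pair; field); done.
Qed.

Lemma measurable_halfplane (R : realType) (a b c : R) :
  measurable [set p : R2 R | a * p.1 + b * p.2 <= c].
Proof.
have -> : [set p : R2 R | a * p.1 + b * p.2 <= c] =
  (fun p : R2 R => a * p.1 + b * p.2 + 0 : measurableTypeR R) @^-1` `]-oo, c].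
  by apply/seteqP; split => p /=; rewrite in_itv /= addr0.
rewrite -[X in measurable X]setTI; apply: measurable_affine2 => //.
Qed.

Lemma measurable_line (R : realType) (a b c : R) :
  measurable [set p : R2 R | a * p.1 + b * p.2 = c].
Proof.
have -> : [set p : R2 R | a * p.1 + b * p.2 = c] =
  [set p : R2 R | a * p.1 + b * p.2 <= c] `&` [set p : R2 R | - a * p.1 + - b * p.2 <= - c].
  by apply/seteqP; split => p /=; [move=> <-; split; lra|move=> [h1 h2]; lra].
by apply: measurableI; apply: measurable_halfplane.
Qed.

(** The similarity with rows [(a, b)] and [(- b, a)], of determinant [a^2 + b^2], turns the line
    into the vertical line [{c} x R], which is null. *)
Lemma leb2_line (R : realType) (a b c : R) : (a != 0) || (b != 0) ->
  leb2 R [set p : R2 R | a * p.1 + b * p.2 = c] = 0%E.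
Proof.
move=> ab.
have D0 : a * a - b * - b != 0.
  by rewrite mulrN opprK -!expr2 paddr_eq0 ?sqr_ge0 // !sqrf_eq0 -negb_and in ab *.
have mX : measurable ([set c] `*` setT : set (R2 R)) by apply: measurableX.
have := leb2_affine 0 0 D0 mX.
rewrite product_measure1E // [X in (X * _)%E](_ : _ = 0%E);
  last exact: lebesgue_measure_set1.
rewrite mul0e.
have -> : (fun p : R2 R => (a * p.1 + b * p.2 + 0, - b * p.1 + a * p.2 + 0)%R : R2 R)
   @^-1` ([set c] `*` setT) = [set p : R2 R | a * p.1 + b * p.2 = c].
  by apply/seteqP; split => p /=; rewrite addr0 //; case.
by move/esym/eqP; rewrite mule_eq0 eqe normr_eq0 (negbTE D0) /= => /eqP.
Qed.

Lemma integral_affine (R : realType) (a b m k : R) (b0 b1 : bool) : a <= b ->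
  (\int[lebesgue_measure]_(x in [set` Interval (BSide b0 a) (BSide b1 b)]) (m * x + k)%:E =
   ((b - a) * (m * (a + b) / 2 + k))%:E)%E.
Proof.
move=> ab.
have mm : measurable_fun setT (fun x : measurableTypeR R => (m * x +
  k)%R : measurableTypeR R).
  exact: measurable_affine1.
have mo : measurable_fun (`]a, b[ : set (measurableTypeR R)) (fun x => (m * x + k)%:E).
  by apply/measurable_EFinP; exact: measurable_funTS.
rewrite integral_itv_bndoo // -(integral_itv_bndoo true false) //.
have := ab; rewrite le_eqVlt => /predU1P[<-|ab'].
  by rewrite set_itv1 integral_set1 subrr mul0r.
pose F : R -> R := fun x => (m / 2 * x ^+ 2 + k * x)%R.
have dF x : is_derive (x : R) 1 F (m * x + k).
  by rewrite /F; apply: is_derive_eq; rewrite /GRing.scale /=; field.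
have cF : continuous F.
  by move=> z; apply/differentiable_continuous/derivable1_diffP; have [] := dF z.
rewrite (@continuous_FTC2 _ _ F) //.
- by rewrite -EFinD; congr EFin; rewrite /F; field.
- apply: continuous_subspaceT => x; apply: cvgD; last exact: cvg_cst.
  by apply: cvgM; [exact: cvg_cst|exact: cvg_id].
- split; first by move=> x _; have [] := dF x.
  + exact/cvg_at_right_filter/cF.
  + exact/cvg_at_left_filter/cF.
- by move=> x _; rewrite derive1E; have [_ ->] := dF x.
Qed.

(** The flags [b0] and [b1] let the formula serve disjoint half-open strips as well as closed
    figures. *)
Lemma leb2_trapezoid (R : realType) (a b m k m' k' : R) (b0 b1 : bool) :
  a <= b -> m * a + k <= m' * a + k' -> m * b + k <= m' * b + k' ->
  let T := [set p : R2 R | p.1 \in Interval (BSide b0 a) (BSide b1 b) /\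
              m * p.1 + k <= p.2 <= m' * p.1 + k'] in
  measurable T /\
  leb2 R T = ((b - a) * ((m' - m) * (a + b) / 2 + (k' - k)))%:E.
Proof.
move=> ab la lb T.
set I := Interval _ _ in T *.
have mT : measurable T.
  have -> : T = ([set` I] `*` setT) `&`
     ([set p : R2 R | m * p.1 + (-1) * p.2 <= - k] `&`
       [set p : R2 R | - m' * p.1 + 1 * p.2 <= k']).
    apply/seteqP; split => p /=.
      by move=> [pI /andP[h1 h2]]; split => //; split; lra.
    by move=> [[pI _] [h1 h2]]; split => //; apply/andP; split; lra.
  apply: measurableI; last by apply: measurableI; exact: measurable_halfplane.
  by apply: measurableX => //; exact: measurable_itv.
split => //.
rewrite -(integral_affine (m' - m) (k' - k) b0 b1 ab) /product_measure1 -/I.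
rewrite [RHS]integral_mkcond; apply: eq_integral => x _ /=.
rewrite patchE; case: ifPn => [/set_mem xI|/negP xI]; last first.
  rewrite (_ : xsection T x = set0) ?measure0 //.
  by rewrite -subset0 => y; rewrite /xsection /= => /set_mem[yI _]; case: xI; exact/mem_set.
have -> : xsection T x = `[m * x + k, m' * x + k']%classic.
  apply/seteqP; split => y; rewrite /xsection /= in_itv /=; first by move/set_mem => -[].
  by move=> h; apply: mem_set.
have /andP[ax xb] : a <= x <= b.
  by move: xI; rewrite /I /= in_itv /=; case: (b0); case: (b1) => /= /andP[h1 h2];
    rewrite ?h1 ?h2 ?(ltW h1) ?(ltW h2).
have le : m * x + k <= m' * x + k'.
  rewrite -subr_ge0.
  have := ab; rewrite le_eqVlt => /predU1P[eab|ab'].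
    have -> : x = a by apply/eqP; rewrite eq_le ax eab xb.
    by rewrite subr_ge0.
  (* Between the ends, the height is a convex combination of its two end values. *)
  have E : (b - a) * (m' * x + k' - (m * x + k)) =
    (b - x) * (m' * a + k' - (m * a + k)) + (x - a) * (m' * b + k' - (m * b + k)) by ring.
  rewrite -(pmulr_rge0 _ (_ : 0 < b - a)) ?subr_gt0 // E.
  by apply: addr_ge0; apply: mulr_ge0; rewrite subr_ge0.
rewrite lebesgue_measure_itv /= lte_fin; case: ltP => h.
  by rewrite -EFinD; congr EFin; ring.
by have -> : (m' - m) * x + (k' - k) = 0 by lra.
Qed.

(** * Vectors and affine dimension *)

Local Notation i0 := (@Ordinal 3 0 isT).
Local Notation i1 := (@Ordinal 3 1 isT).
Local Notation i2 := (@Ordinal 3 2 isT).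

Lemma ord3_ind (P : 'I_3 -> Prop) : P i0 -> P i1 -> P i2 -> forall i, P i.
Proof.
move=> h0 h1 h2 [[|[|[|//]]] h].
- by rewrite (bool_irrelevance h isT).
- by rewrite (bool_irrelevance h isT).
- by rewrite (bool_irrelevance h isT).
Qed.

Definition vec (R : realType) (x y z : R) : 'rV[R]_3 := \row_j [:: x; y; z]`_j.

Definition cross (R : realType) (u v : 'rV[R]_3) : 'rV[R]_3 :=
  vec (u 0 i1 * v 0 i2 - u 0 i2 * v 0 i1)
      (u 0 i2 * v 0 i0 - u 0 i0 * v 0 i2)
      (u 0 i0 * v 0 i1 - u 0 i1 * v 0 i0).

Lemma eq_rV3 (R : realType) (u v : 'rV[R]_3) :
  u 0 i0 = v 0 i0 -> u 0 i1 = v 0 i1 -> u 0 i2 = v 0 i2 -> u = v.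
Proof. by move=> h0 h1 h2; apply/rowP; apply: ord3_ind. Qed.

Lemma dotE (R : realType) (u v : 'rV[R]_3) :
  dot u v = u 0 i0 * v 0 i0 + u 0 i1 * v 0 i1 + u 0 i2 * v 0 i2.
Proof.
rewrite /dot !big_ord_recl big_ord0 addr0 addrA.
by congr (_ * _ + _ * _ + _ * _); congr (_ _ _); apply: val_inj.
Qed.

Ltac vsimp := rewrite ?dotE /cross /vec ?mxE /=.
Ltac vring := apply: eq_rV3; vsimp; ring.
Ltac dring := vsimp; ring.

Section Vectors.
Variable R : realType.
Implicit Types (a b u v w d : 'rV[R]_3) (F : set 'rV[R]_3).

Lemma dotC u v : dot u v = dot v u. Proof. dring. Qed.
Lemma dotDr u v w : dot u (v + w) = dot u v + dot u w. Proof. dring. Qed.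
Lemma dotBr u v w : dot u (v - w) = dot u v - dot u w. Proof. dring. Qed.
Lemma dotZr u (k : R) v : dot u (k *: v) = k * dot u v. Proof. dring. Qed.
Lemma dotBl u v w : dot (v - w) u = dot v u - dot w u. Proof. dring. Qed.
Lemma dotZl u (k : R) v : dot (k *: v) u = k * dot v u. Proof. dring. Qed.
Lemma dot0r u : dot u 0 = 0. Proof. dring. Qed.

Lemma dot_ge0 u : 0 <= dot u u.
Proof. by rewrite dotE; do 2?apply: addr_ge0; rewrite -expr2 sqr_ge0. Qed.

Lemma dot_eq0 u : (dot u u == 0) = (u == 0).
Proof.
apply/idP/eqP => [|->]; last by rewrite dot0r.
rewrite dotE !paddr_eq0 -?expr2 ?addr_ge0 ?sqr_ge0 // !sqrf_eq0.
move=> /andP[/andP[/eqP h0 /eqP h1] /eqP h2].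
by apply: eq_rV3; rewrite ?h0 ?h1 ?h2 mxE.
Qed.

Lemma dot_gt0 u : u != 0 -> 0 < dot u u.
Proof. by move=> u0; rewrite lt_neqAle dot_ge0 eq_sym dot_eq0 u0. Qed.

Lemma dot_crossl u v : dot u (cross u v) = 0. Proof. dring. Qed.
Lemma dot_crossr u v : dot v (cross u v) = 0. Proof. dring. Qed.

Lemma cross_parallel a u : a != 0 -> cross a u = 0 -> u = (dot a u / dot a a) *: a.
Proof.
move=> a0 c0; have aa := dot_gt0 a0.
have E : dot a a *: u = dot a u *: a + cross (cross a u) a by vring.
have : dot a a *: u = dot a u *: a.
  by rewrite E c0; apply: eq_rV3; vsimp; ring.
move/(congr1 (fun x => (dot a a)^-1 *: x)); rewrite !scalerA mulVf ?gt_eqF //.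
by rewrite scale1r mulrC.
Qed.

(* Expansion in the basis [d1, d2, d1 x d2]. *)
Lemma cross_expand d1 d2 v : let N := cross d1 d2 in
  dot N N *: v = dot (cross v d2) N *: d1 + dot (cross d1 v) N *: d2 + dot v N *: N.
Proof. vring. Qed.

(* Expansion in the dual basis. *)
Lemma cross_expand_dual d1 d2 v : let N := cross d1 d2 in
  dot N N *: v = dot v d1 *: cross d2 N + dot v d2 *: cross N d1 + dot v N *: N.
Proof. vring. Qed.

Lemma normal_parallel d1 d2 a : cross d1 d2 != 0 -> dot a d1 = 0 -> dot a d2 = 0 ->
  a = (dot a (cross d1 d2) / dot (cross d1 d2) (cross d1 d2)) *: cross d1 d2.
Proof.
set N := cross d1 d2 => N0 h1 h2.
have := cross_expand_dual d1 d2 a; rewrite /= -/N h1 h2 !scale0r !add0r.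
move/(congr1 (fun x => (dot N N)^-1 *: x)).
by rewrite !scalerA mulVf ?gt_eqF ?dot_gt0 // scale1r mulrC.
Qed.

Lemma cross_span d1 d2 v : cross d1 d2 != 0 -> dot v (cross d1 d2) = 0 ->
  exists p q : R, v = p *: d1 + q *: d2.
Proof.
set N := cross d1 d2 => N0 h.
have := cross_expand d1 d2 v; rewrite /= -/N h scale0r addr0.
move/(congr1 (fun x => (dot N N)^-1 *: x)).
rewrite scalerA mulVf ?gt_eqF ?dot_gt0 // scale1r scalerDr !scalerA => ->.
by eexists; eexists; reflexivity.
Qed.

Lemma has_affine_dim2 F a (b : R) x0 x1 x2 : a != 0 -> F `<=` plane a b ->
  F x0 -> F x1 -> F x2 -> cross (x1 - x0) (x2 - x0) != 0 -> has_affine_dim F 2.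
Proof.
move=> a0 Fa F0 F1 F2; set d1 := x1 - x0; set d2 := x2 - x0 => N0.
split; first by exists x0.
have ad x y : F x -> F y -> dot a (x - y) = 0.
  by rewrite dotBr => /Fa -> /Fa ->; rewrite subrr.
have d20 : d2 != 0.
  by apply: contraNneq N0 => ->; apply/eqP; vring.
exists <<[:: d1; d2]>>%VS; split.
  suff fr : free [:: d1; d2] by move: fr; rewrite /free /= => /eqP.
  rewrite free_cons span_seq1 seq1_free d20 andbT.
  apply: contra N0 => /vlineP[k ->]; apply/eqP; vring.
move=> W; split.
  move=> VW x y Fx Fy.
  (* The normal [a] is a multiple of the cross product of [d1] and [d2], so all differences of
     points of [F] are spanned by [d1] and [d2]. *)
  have an := normal_parallel N0 (ad _ _ F1 F0) (ad _ _ F2 F0).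
  have : dot (x - y) (cross d1 d2) = 0.
    have := ad _ _ Fx Fy; rewrite an dotZl => /eqP; rewrite mulf_eq0.
    case/orP => [|/eqP h]; last by rewrite dotC.
    by move=> /eqP k0; move: an; rewrite k0 scale0r => /eqP; rewrite (negbTE a0).
  case/(cross_span N0) => p [q ->].
  apply: (subvP VW); apply: rpredD; apply: rpredZ; apply: memv_span;
    by rewrite !inE eqxx ?orbT.
move=> FW; apply/span_subvP => z; rewrite !inE => /orP[]/eqP->; exact: FW.
Qed.

Lemma exists_not_parallel a : a != 0 -> exists d, cross a d != 0.
Proof.
move=> a0; apply/not_existsP => h.
have hc d : cross a d = 0 by apply/eqP; apply: contrapT => /negP; exact: h.
move: a0; apply/negP; rewrite negbK; apply/eqP; apply: eq_rV3.
- by have := congr1 (fun u : 'rV[R]_3 => u 0 i2) (hc (vec 0 1 0)); vsimp => <-; ring.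
- by have := congr1 (fun u : 'rV[R]_3 => u 0 i0) (hc (vec 0 0 1)); vsimp => <-; ring.
- by have := congr1 (fun u : 'rV[R]_3 => u 0 i1) (hc (vec 1 0 0)); vsimp => <-; ring.
Qed.

(** Separates facets from degenerate faces: without three non-collinear points, [F] lies on a line,
    hence in a second plane transversal to the first. *)
Lemma affine_dim2_or_line F a (b : R) : a != 0 -> F `<=` plane a b -> F !=set0 ->
  has_affine_dim F 2 \/ exists w c, cross a w != 0 /\ F `<=` plane w c.
Proof.
move=> a0 Fa [x0 F0].
have ad x y : F x -> F y -> dot a (x - y) = 0.
  by rewrite dotBr => /Fa -> /Fa ->; rewrite subrr.
have [[x1 [x2 [F1 F2 N0]]]|h] := pselect (exists x1 x2, [/\ F x1, F x2 &
  cross (x1 - x0) (x2 - x0) != 0]).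
  by left; exact: (has_affine_dim2 a0 Fa F0 F1 F2 N0).
right; have hc x1 x2 : F x1 -> F x2 -> cross (x1 - x0) (x2 - x0) = 0.
  move=> F1 F2; apply/eqP; apply: contrapT => /negP N0; apply: h.
  by exists x1, x2.
have [[x1 [F1 d0]]|h1] := pselect (exists x1, F x1 /\ x1 - x0 != 0).
  (* All of [F] lies on the line through [x0] and [x1]; the plane containing this line and the
     direction [a] is transversal to the given one. *)
  exists (cross a (x1 - x0)), (dot (cross a (x1 - x0)) x0).
  have ax := ad _ _ F1 F0; set d := x1 - x0 in d0 ax *.
  split; last first.
    move=> x Fx; apply/eqP; rewrite -subr_eq0 -dotBr; apply/eqP.
    transitivity (dot a (cross d (x - x0))); first by dring.
    by rewrite hc // dot0r.
  have E : cross a (cross a d) = dot a d *: a - dot a a *: d by vring.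
  rewrite E ax scale0r sub0r oppr_eq0 scaler_eq0 (negbTE d0) orbF.
  by rewrite gt_eqF // dot_gt0.
(* [F] is the single point [x0], and any transversal plane through it will do. *)
have [d hd] := exists_not_parallel a0.
exists d, (dot d x0); split => // x Fx /=.
have -> : x = x0 => //.
apply/eqP; rewrite -subr_eq0; apply: contrapT => /negP h2; apply: h1.
by exists x.
Qed.

(** With independent normals all differences would be multiples of [cross a u], and the dimension
    would be at most one. *)
Lemma affine_dim2_parallel F a u (b c : R) : has_affine_dim F 2 ->
  F `<=` plane a b -> F `<=` plane u c -> cross a u = 0.
Proof.
move=> [_ [V [dV VP]]] Fa Fu; apply/eqP; apply: contrapT => /negP N0.
have : (V <= <[cross a u]>)%VS.
  apply/VP => x y Fx Fy; apply/vlineP.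
  have ha : dot (x - y) a = 0 by rewrite dotC dotBr (Fa x Fx) (Fa y Fy) subrr.
  have hu : dot (x - y) u = 0 by rewrite dotC dotBr (Fu x Fx) (Fu y Fy) subrr.
  by eexists; exact: (normal_parallel N0 ha hu).
by move/dimvS; rewrite dV dim_vline; case: (_ == _).
Qed.

End Vectors.

(** * Facets of polyhedra *)

Definition polyhedron (R : realType) (m : nat) (a : 'I_m -> 'rV[R]_3) (b : 'I_m -> R)
  : set 'rV[R]_3 := [set x | forall i, dot (a i) x <= b i].

(** Unlike a [facet], this set may be empty or of any dimension. *)
Definition face_of (R : realType) (m : nat) (a : 'I_m -> 'rV[R]_3) (b : 'I_m -> R)
  (i : 'I_m) : set 'rV[R]_3 := polyhedron a b `&` plane (a i) (b i).

Section Faces.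
Variable R : realType.
Implicit Types (P F : set 'rV[R]_3) (u v x y : 'rV[R]_3).

Lemma continuous_dot u : continuous (dot u : 'rV[R]_3 -> R).
Proof.
have -> : dot u = fun v => u 0 i0 * v 0 i0 + u 0 i1 * v 0 i1 + u 0 i2 * v 0 i2.
  by apply/funext => v; rewrite dotE.
have c i : continuous (fun v : 'rV[R]_3 => u 0 i * v 0 i).
  move=> x; apply: (@continuous_comp _ _ _ (fun v : 'rV[R]_3 => v 0 i) ( *%R (u 0 i))).
    exact: coord_continuous.
  exact: mulrl_continuous.
by move=> x; apply: (cvgD (cvgD (c i0 x) (c i1 x)) (c i2 x)).
Qed.

Lemma open_halfspace u (c : R) : open [set x | dot u x < c].
Proof.
rewrite (_ : [set x | _] = dot u @^-1` [set r | r < c]) //.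
by apply: open_comp => [x _|]; [exact: continuous_dot|exact: open_lt].
Qed.

Lemma interior_polyhedron m (a : 'I_m -> 'rV[R]_3) (b : 'I_m -> R) x :
  (forall i, dot (a i) x < b i) -> (polyhedron a b)° x.
Proof.
move=> h; have : \forall y \near x, forall i : 'I_m, dot (a i) y < b i.
  apply: (@filter_forall _ _ (fun i => [set y | dot (a i) y < b i]) (nbhs x) _) => i.
  apply: (@open_nbhs_nbhs _ x [set y | dot (a i) y < b i]).
  by split; [exact: open_halfspace|exact: h].
by apply: filterS => y hy i; exact: ltW.
Qed.

Lemma interior_move P x u : P° x -> exists e : R, 0 < e /\ P (x + e *: u).
Proof.
move=> Px; have h : (fun t : R => x + t *: u) @ 0^'+ --> x.
  apply: cvg_at_right_filter; rewrite -[X in _ --> X]addr0 -(scale0r u).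
  apply: cvgD; first exact: cvg_cst.
  by apply: cvgZ; [exact: cvg_id|exact: cvg_cst].
have h1 : \forall t \near (0:R)^'+, P (x + t *: u) by exact: h.
have h2 : \forall t \near (0:R)^'+, 0 < t by exact: nbhs_right_gt.
by have [e [He e0]] := filter_ex (filterI h1 h2); exists e.
Qed.

Lemma interior_not_argmin P u (c : R) : P° !=set0 -> u != 0 ->
  (forall y, P y -> dot u y <= c) -> exists2 y, P y & dot u y < c.
Proof.
move=> [x Px] u0 h; have [e [e0 Pe]] := interior_move u Px.
exists x; first exact: interior_subset.
by have := h _ Pe; apply: lt_le_trans; rewrite dotDr dotZr ltrDl mulr_gt0 // dot_gt0.
Qed.

Section Polyhedron.
Variables (m : nat) (a : 'I_m -> 'rV[R]_3) (b : 'I_m -> R).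
Let P := polyhedron a b.
Hypothesis P0 : P° !=set0.

(** As [P] has an interior, some point of it lies strictly below the plane of constraint [i]; a
    negative factor would lift this point above the maximum of [dot u]. *)
Lemma exposed_scale_gt0 u i (l : R) x : u != 0 -> u = l *: a i ->
  P x -> (forall y, P y -> dot u y <= dot u x) -> dot (a i) x = b i -> 0 < l.
Proof.
move=> u0 uE Px hx ax; rewrite ltNge; apply/negP => l0.
have ai0 : a i != 0 by apply: contraNneq u0 => ai0; rewrite uE ai0 scaler0.
have [y Py hy] := interior_not_argmin P0 ai0 (fun y (hy : P y) => hy i).
have := hx y Py; rewrite uE !dotZl ax.
have ln : l < 0.
  by rewrite lt_neqAle l0 andbT; apply: contraNneq u0 => l00; rewrite uE l00 scale0r.
by rewrite ler_nM2l // leNgt hy.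
Qed.

(** Otherwise [x] would be slack in every constraint with nonzero normal, and could be moved in
    direction [u] inside [P]. *)
Lemma facet_normal_active u x : u != 0 -> P x ->
  (forall y, P y -> dot u y <= dot u x) ->
  exists2 i, a i != 0 & dot (a i) x = b i.
Proof.
move=> u0 Px hx; apply/not_exists2P => h.
have hs i : a i != 0 -> dot (a i) x < b i.
  move=> ai0; have [//|] := h i; rewrite lt_neqAle Px andbT => n.
  by apply/eqP.
have [|e [e0 Pe]] := @interior_move P x u.
  have : \forall y \near x, forall i : 'I_m, dot (a i) y <= b i.
    apply: (@filter_forall _ _ (fun i => [set y | dot (a i) y <= b i]) (nbhs x) _) => i.
    have [ai0|ai0] := eqVneq (a i) 0.
      rewrite (_ : [set y | _] = setT); first exact: filterT.
      apply/seteqP; split => y //= _; move: (Px i); rewrite ai0.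
      by rewrite ![dot 0 _]dotC !dot0r.
    have : \forall y \near x, dot (a i) y < b i.
      apply: (@open_nbhs_nbhs _ x [set y | dot (a i) y < b i]).
      by split; [exact: open_halfspace|exact: hs].
    by apply: filterS => y; exact: ltW.
  by apply: filterS => y hy i.
by have := hx _ Pe; rewrite dotDr dotZr gerDl leNgt mulr_gt0 // dot_gt0.
Qed.

Lemma midpoint_argmax u x y : P x -> P y ->
  (forall z, P z -> dot u z <= dot u x) -> (forall z, P z -> dot u z <= dot u y) ->
  let w := 2^-1 *: (x + y) in P w /\ forall z, P z -> dot u z <= dot u w.
Proof.
move=> Px Py hx hy w; split.
  by move=> i; rewrite /w dotZr dotDr; have := Px i; have := Py i; lra.
by move=> z Pz; rewrite /w dotZr dotDr; have := hx z Pz; have := hy z Pz; lra.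
Qed.

(** Some constraint is tight on all of [F]. Its plane and the supporting plane of normal [u] share a
    two-dimensional set, so the normals are parallel, and [exposed_scale_gt0] gives them the same
    direction. *)
Lemma facetE F : facet P F -> exists2 i, a i != 0 & F = face_of a b i.
Proof.
move=> [[u [u0 FE]] F2].
have [i ai0 Fi] : exists2 i, a i != 0 & F `<=` plane (a i) (b i).
  apply/not_exists2P => h.
  (* Averaging points of [F] that are slack in single constraints gives one that is slack in all the
     listed constraints; for the full list this contradicts [facet_normal_active]. *)
  have hs (s : seq 'I_m) : exists2 g, F g &
      forall i, i \in s -> a i != 0 -> dot (a i) g < b i.
    elim: s => [|i s [g Fg IH]]; first by have [[g Fg] _] := F2; exists g.
    have [ai0|ai0] := eqVneq (a i) 0.
      exists g => // j; rewrite inE => /orP[/eqP ->|]; last exact: IH.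
      by rewrite ai0 eqxx.
    have [//|nF] := h i; have /existsNP[g' /not_implyP[Fg' n]] := nF.
    exists (2^-1 *: (g + g')).
      move: Fg Fg'; rewrite FE => -[Pg hg] [Pg' hg']; exact: midpoint_argmax.
    have Pg : P g by move: Fg; rewrite FE => -[].
    have Pg' : P g' by move: Fg'; rewrite FE => -[].
    have lt' : dot (a i) g' < b i.
      by rewrite lt_neqAle Pg' andbT; apply/eqP.
    move=> j; rewrite inE dotZr dotDr => /orP[/eqP -> _|js aj0].
      by have := Pg i; lra.
    by have := IH j js aj0; have := Pg' j; lra.
  have [g Fg hg] := hs (enum 'I_m).
  move: Fg; rewrite FE => -[Pg hg'].
  have [i ai0 E] := facet_normal_active u0 Pg hg'.
  by have := hg i (mem_enum _ _) ai0; rewrite E ltxx.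
exists i => //.
have [[g Fg] _] := F2.
have Pg : P g by move: Fg; rewrite FE => -[].
have hg y : P y -> dot u y <= dot u g by move: Fg; rewrite FE => -[_]; apply.
have Fu : F `<=` plane u (dot u g).
  move=> y; rewrite FE => -[Py hy] /=; apply/eqP; rewrite eq_le; apply/andP; split.
    exact: hg.
  exact: hy.
have c0 := affine_dim2_parallel F2 Fi Fu.
have uE := cross_parallel ai0 c0.
have l0 := exposed_scale_gt0 u0 uE Pg hg (Fi g Fg).
apply/seteqP; split => x.
  by move=> Fx; split; [move: Fx; rewrite FE => -[]|exact: Fi].
move=> [Px hx]; rewrite FE; split => // y Py.
by rewrite uE !dotZl ler_pM2l // hx; exact: Py.
Qed.

Lemma face_of_facet i : a i != 0 -> has_affine_dim (face_of a b i) 2 ->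
  facet P (face_of a b i).
Proof.
move=> ai0 d2; split => //; exists (a i); split => //.
have [[g [Pg hg]] _] := d2.
apply/seteqP; split => x [Px hx]; split => //.
  by move=> y Py; rewrite hx; exact: Py.
by apply/eqP; rewrite eq_le Px /= -hg hx.
Qed.

(** The exit parameter is the least of the times [f i] at which the ray reaches the planes of the
    constraints with [dot (a i) u < 0]. Boundedness of [P] provides such a constraint. *)
Lemma ray_exit u x : bounded_set P -> u != 0 -> P x ->
  exists i (s : R), [/\ dot (a i) u < 0, face_of a b i (x - s *: u) & 0 <= s].
Proof.
move=> [M [Mr hM]] u0 Px.
have [[i1 hi1]|h] := pselect (exists i, dot (a i) u < 0); last first.
  exfalso; have hp i : 0 <= dot (a i) u.
    by rewrite leNgt; apply/negP => hi; apply: h; exists i.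
  have un : 0 < `|u| by rewrite normr_gt0.
  (* Chosen so that [s *: u] has norm [|M| + |x| + 2], which takes the ray out of the ball of radius
     [|M| + 1]. *)
  pose s := (`|M| + 1 + `|x| + 1) / `|u|.
  have s0 : 0 <= s by rewrite divr_ge0 // !addr_ge0.
  have Ps : P (x - s *: u).
    move=> i; apply: le_trans (Px i).
    by rewrite dotBr dotZr gerBl mulr_ge0.
  have /hM/(_ _ Ps) : M < `|M| + 1 by rewrite ltr_pwDr // ler_norm.
  have := lerB_dist (s *: u) x; rewrite normrZ ger0_norm // /s divfK ?gt_eqF //.
  rewrite [`|_ - x|]distrC /=; lra.
pose f i := (b i - dot (a i) x) / (- dot (a i) u).
case: (@Order.TotalTheory.arg_minP _ _ _ i1 (fun i => dot (a i) u < 0) f hi1) => i hi hmin.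
exists i, (f i); split => //; last first.
  by apply: divr_ge0; rewrite ?subr_ge0 ?oppr_ge0 ?(ltW hi) //; exact: Px.
split; last first.
  by rewrite /plane /= dotBr dotZr /f; field; rewrite ?oppr_eq0 lt_eqF.
move=> k; rewrite dotBr dotZr.
have [hk|hk] := ltP (dot (a k) u) 0.
  have := hmin k hk; rewrite {2}/f ler_pdivlMr ?oppr_gt0 //; lra.
have fi0 : 0 <= f i.
  by apply: divr_ge0; rewrite ?subr_ge0 ?oppr_ge0 ?(ltW hi) //; exact: Px.
by have := Px k; have := mulr_ge0 fi0 hk; lra.
Qed.

End Polyhedron.
End Faces.

(** * Necessity *)

Section Necessity.
Variable R : realType.
Implicit Types (P F : set 'rV[R]_3) (u v x y o e f : 'rV[R]_3).

Definition chart o e1 e2 (p : R2 R) : 'rV[R]_3 := o + p.1 *: e1 + p.2 *: e2.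

Lemma dot_chart u o e1 e2 p :
  dot u (chart o e1 e2 p) = dot u o + p.1 * dot u e1 + p.2 * dot u e2.
Proof. by rewrite /chart !dotDr !dotZr. Qed.

Lemma measurable_face_chart m (a : 'I_m -> 'rV[R]_3) (b : 'I_m -> R) i o e1 e2 :
  measurable (chart o e1 e2 @^-1` face_of a b i).
Proof.
have -> : chart o e1 e2 @^-1` face_of a b i =
  (\bigcap_(j in [set: 'I_m]) [set p : R2 R | dot (a j) e1 * p.1 +
    dot (a j) e2 * p.2 <= b j - dot (a j) o])
  `&` [set p : R2 R | dot (a i) e1 * p.1 + dot (a i) e2 * p.2 = b i - dot (a i) o].
  apply/seteqP; split => p /=.
    move=> [h1 h2]; split => [j _ /=|].
      by have := h1 j; rewrite dot_chart; lra.
    by move: h2; rewrite /plane /= dot_chart; lra.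
  move=> [h1 h2]; split => [j|].
    by have := h1 j I; rewrite /= dot_chart; lra.
  by rewrite /plane /= dot_chart; lra.
apply: measurableI; last exact: measurable_line.
by apply: fin_bigcap_measurable => // j _; exact: measurable_halfplane.
Qed.

(** Ties the arbitrary frame in which an area is measured to the normals of the facet. *)
Lemma frame_normal F o e1 e2 u (c : R) :
  dot e1 e1 = 1 -> dot e2 e2 = 1 -> dot e1 e2 = 0 ->
  F `<=` [set o + p.1 *: e1 + p.2 *: e2 | p in [set: R * R]] ->
  has_affine_dim F 2 -> F `<=` plane u c ->
  exists l : R, u = l *: cross e1 e2.
Proof.
move=> h1 h2 h12 Fo F2 Fu.
have N0 : cross e1 e2 != 0.
  rewrite -dot_eq0.
  have -> : dot (cross e1 e2) (cross e1 e2) =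
    dot e1 e1 * dot e2 e2 - dot e1 e2 ^+ 2 by dring.
  by rewrite h1 h2 h12 mulr1 expr0n /= subr0 oner_eq0.
have FN : F `<=` plane (cross e1 e2) (dot (cross e1 e2) o).
  move=> x /Fo[p _ <-]; rewrite /plane /= !dotDr !dotZr.
  by rewrite ![dot (cross _ _) _]dotC dot_crossl dot_crossr !mulr0 !addr0.
by eexists; exact: (cross_parallel N0 (affine_dim2_parallel F2 FN Fu)).
Qed.

Lemma dot_cross_cross e1 e2 f1 f2 :
  dot (cross e1 e2) (cross f1 f2) = dot e1 f1 * dot e2 f2 - dot e1 f2 * dot e2 f1.
Proof. dring. Qed.

(** Lagrange's identity for two unit normals; the quantity bounded is the cosine of the angle
    between the planes. *)
Lemma dot_cross_cross_le1 e1 e2 f1 f2 :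
  dot e1 e1 = 1 -> dot e2 e2 = 1 -> dot e1 e2 = 0 ->
  dot f1 f1 = 1 -> dot f2 f2 = 1 -> dot f1 f2 = 0 ->
  `|dot (cross e1 e2) (cross f1 f2)| <= 1.
Proof.
move=> h1 h2 h12 g1 g2 g12.
rewrite -(@ler_pXn2r _ 2) ?nnegrE // expr1n real_normK ?num_real //.
have E u v : dot u v ^+ 2 + dot (cross u v) (cross u v) = dot u u * dot v v by dring.
have := E (cross e1 e2) (cross f1 f2).
rewrite [dot (cross e1 e2) (cross e1 e2)]dot_cross_cross.
rewrite [dot (cross f1 f2) (cross f1 f2)]dot_cross_cross [dot e2 e1]dotC [dot f2 f1]dotC.
rewrite h1 h2 h12 g1 g2 g12 !mulr0 !subr0 !mulr1 => <-.
by rewrite lerDl dot_ge0.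
Qed.

(* [B] is the shadow of [F] in the plane of the frame [(o, e1, e2)]; it is empty
   when [F] is parallel to the normal [u] of this plane. *)
Lemma shadow_area_le F (A : R) o e1 e2 (l : R) :
  dot e1 e1 = 1 -> dot e2 e2 = 1 -> dot e1 e2 = 0 -> l != 0 ->
  (forall oF f1 f2, measurable (chart oF f1 f2 @^-1` F)) ->
  has_affine_dim F 2 -> has_area F A ->
  exists B : set (R2 R), [/\ measurable B, (leb2 R B <= A%:E)%E &
    forall u p (s : R) v (c : R), u = l *: cross e1 e2 -> F `<=` plane v c ->
      dot v u != 0 -> F (chart o e1 e2 p - s *: u) -> B p].
Proof.
move=> h1 h2 h12 l0 mF F2 [oF [f1 [f2 [g1 g2 g12 Fo' HA]]]].
(* [D] is the Jacobian of the orthogonal projection from the plane of [F]; if it vanishes, this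
   plane is parallel to [u], against [dot v u != 0]. *)
pose D := dot (cross e1 e2) (cross f1 f2).
have [D0|D0] := eqVneq D 0.
  exists set0; split => //; first by rewrite measure0 -HA measure_ge0.
  move=> u p s v c uE Fv vu; exfalso; move: vu.
  have [k ->] := frame_normal g1 g2 g12 Fo' F2 Fv.
  by rewrite uE dotZl dotZr dotC -/D D0 !mulr0 eqxx.
pose al := dot e1 f1; pose be := dot e1 f2; pose ga := dot e1 (oF - o).
pose al' := dot e2 f1; pose be' := dot e2 f2; pose ga' := dot e2 (oF - o).
have DE : D = al * be' - be * al' by rewrite /D dot_cross_cross.
pose S : set (R2 R) := chart oF f1 f2 @^-1` F.
have mS : measurable S by exact: mF.
(* [T] inverts the projection: it maps a shadow point to the coordinates of the point of [F] casting
   it. Its determinant [D^-1] is at least one in absolute value, so the shadow is no larger than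
   [F]. *)
pose T (p : R2 R) : R2 R := ((be' / D) * p.1 + (- be / D) * p.2 + (be * ga' - be' * ga) / D,
  (- al' / D) * p.1 + (al / D) * p.2 + (al' * ga - al * ga') / D).
have detT : be' / D * (al / D) - (- be / D) * (- al' / D) = D^-1.
  by rewrite DE; field; rewrite -DE.
have detT0 : be' / D * (al / D) - (- be / D) * (- al' / D) != 0.
  by rewrite detT invr_eq0.
exists (T @^-1` S); split.
- exact: measurable_affine_preimage.
- have := leb2_affine ((be * ga' - be' * ga) / D) ((al' * ga - al * ga') / D) detT0 mS.
  have -> : leb2 R S = A%:E by exact: HA.
  rewrite detT -/T => ->; rewrite -[leLHS]mul1e.
  apply: lee_wpmul2r; first exact: measure_ge0.
  by rewrite lee_fin normfV invf_ge1 ?normr_gt0 // dot_cross_cross_le1.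
move=> u p s v c uE _ _ Fp; rewrite /= /S /=.
have [q _ qE] := Fo' _ Fp.
have pE e : dot e u = 0 -> dot e (chart o e1 e2 p) = dot e (chart oF f1 f2 q).
  by move=> eu; rewrite /chart qE dotBr dotZr eu mulr0 subr0.
have e1u : dot e1 u = 0 by rewrite uE dotZr dot_crossl mulr0.
have e2u : dot e2 u = 0 by rewrite uE dotZr dot_crossr mulr0.
have := pE _ e1u; rewrite !dot_chart h1 h12 -/al -/be => E1.
have := pE _ e2u; rewrite !dot_chart h2 [dot e2 e1]dotC h12 -/al' -/be' => E2.
suff -> : T p = q by rewrite /chart qE.
have E1' : p.1 = al * q.1 + be * q.2 + ga by rewrite /ga dotBr; lra.
have E2' : p.2 = al' * q.1 + be' * q.2 + ga' by rewrite /ga' dotBr; lra.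
rewrite [q]surjective_pairing /T E1' E2' DE; congr pair; field; by rewrite -DE.
Qed.

(** The combination [w'] of the two normals is orthogonal to the direction of projection, so its
    plane contains [F] together with the projecting lines and meets the plane of the frame in a line
    carrying the shadow. *)
Lemma shadow_line0 F o e1 e2 (l : R) v (c : R) w (d : R) : l != 0 ->
  dot v (l *: cross e1 e2) != 0 -> cross e1 e2 != 0 ->
  F `<=` plane v c -> F `<=` plane w d -> cross v w != 0 ->
  exists B : set (R2 R), [/\ measurable B, leb2 R B = 0%E &
    forall p (s : R), F (chart o e1 e2 p - s *: (l *: cross e1 e2)) -> B p].
Proof.
set u := l *: _ => l0 vu N0 Fv Fw vw.
pose k := dot w u / dot v u; pose w' := w - k *: v.
have w'u : dot w' u = 0 by rewrite /w' dotBl dotZl /k divfK // subrr.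
pose B : set (R2 R) := [set p | dot w' e1 * p.1 + dot w' e2 * p.2 = d - k * c - dot w' o].
exists B; split; first exact: measurable_line.
  apply: leb2_line; rewrite -negb_and; apply/negP => /andP[/eqP we1 /eqP we2].
  have := normal_parallel N0 we1 we2.
  have -> : dot w' (cross e1 e2) = 0.
    by move/eqP: w'u; rewrite /u dotZr mulf_eq0 (negbTE l0) => /eqP.
  rewrite mul0r scale0r /w' => /eqP; rewrite subr_eq0 => /eqP wE.
  by move/eqP: vw; apply; rewrite wE; vring.
move=> p s Fp; rewrite /B /=.
have := Fv _ Fp; have := Fw _ Fp; rewrite /plane /= => hw hv.
have : dot w' (chart o e1 e2 p - s *: u) = d - k * c.
  by rewrite /w' dotBl dotZl hw hv.
by rewrite dotBr dotZr w'u mulr0 subr0 dot_chart; lra.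
Qed.

Lemma leb2_bigsetU_le (I : Type) (s : seq I) (Q : pred I) (B : I -> set (R2 R)) :
  (forall i, measurable (B i)) ->
  measurable (\big[setU/set0]_(i <- s | Q i) B i) /\
  (leb2 R (\big[setU/set0]_(i <- s | Q i) B i) <= \sum_(i <- s | Q i) leb2 R (B i))%E.
Proof.
move=> mB; elim: s => [|i s [m IH]]; first by rewrite !big_nil measure0.
rewrite !big_cons; case: ifP => _ //; split; first exact: measurableU.
by apply: le_trans (measureU2 _ _ _) _ => //; exact: leeD2l.
Qed.

Theorem nonflat_area_le n (F : 'I_n -> set 'rV[R]_3) (A : 'I_n -> R) (k : 'I_n) :
  nonflat_polyhedron F -> (forall i, has_area (F i) (A i)) ->
  A k <= \sum_(j < n | j != k) A j.
Proof.
move=> [P [[bP [m [a [b PE]]]] P0 Finj FP]] HA.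
have {PE}PE : P = polyhedron a b by [].
subst P.
have facF j : facet (polyhedron a b) (F j) by apply/FP; exists j.
have dimF j : has_affine_dim (F j) 2 by have [] := facF j.
have mF j oF f1 f2 : measurable (chart oF f1 f2 @^-1` F j).
  have [i _ ->] := facetE P0 (facF j); exact: measurable_face_chart.
have [org [e1 [e2 [h1 h2 h12 Fo Ak]]]] := HA k.
have [[u [u0 FkE]] _] := facF k.
have [g0 Fg0] : F k !=set0 by have [] := dimF k.
have Pg0 : polyhedron a b g0 by move: Fg0; rewrite FkE => -[].
have ug0 y : polyhedron a b y -> dot u y <= dot u g0.
  by move: Fg0; rewrite FkE => -[_]; apply.
have Fku : F k `<=` plane u (dot u g0).
  move=> x; rewrite FkE => -[Px hx]; apply/eqP; rewrite eq_le ug0 //=; exact: hx.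
have [l uE] := frame_normal h1 h2 h12 Fo (dimF k) Fku.
have l0 : l != 0 by apply: contraNneq u0 => l0; rewrite uE l0 scale0r.
have N0 : cross e1 e2 != 0 by apply: contraNneq u0 => N0; rewrite uE N0 scaler0.
have /choice[B HB] : forall j, exists B : set (R2 R),
  [/\ measurable B, (leb2 R B <= (A j)%:E)%E &
    forall u p (s : R) v (c : R), u = l *: cross e1 e2 -> F j `<=` plane v c ->
      dot v u != 0 -> F j (chart org e1 e2 p - s *: u) -> B p].
  by move=> j; apply: shadow_area_le.
(* [Z i] absorbs the shadow of the [i]-th face when that face is not two-dimensional. *)
have /choice[Z HZ] : forall i, exists Z : set (R2 R),
  [/\ measurable Z, leb2 R Z = 0%E &
    forall p (s : R), dot (a i) u < 0 -> ~ has_affine_dim (face_of a b i) 2 ->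
     face_of a b i (chart org e1 e2 p - s *: u) -> Z p].
  move=> i.
  have [[ai [nd [g Fg]]]|h] := pselect (dot (a i) u < 0 /\
      ~ has_affine_dim (face_of a b i) 2 /\ face_of a b i !=set0); last first.
    by exists set0; split => // p s ai nd Fp; exfalso; apply: h; split => //;
      split => //; eexists; exact: Fp.
  have ai0 : a i != 0.
    by apply: contraTneq ai => ->; rewrite dotC dot0r ltxx.
  have Fi : face_of a b i `<=` plane (a i) (b i) by move=> x [].
  have [//|wd] := affine_dim2_or_line ai0 Fi (ex_intro _ g Fg).
  have [w [d [aw Fw]]] := wd.
  have au : dot (a i) (l *: cross e1 e2) != 0 by rewrite -uE lt_eqF.
  have [Z [mZ Z0 hZ]] := shadow_line0 org l0 au N0 Fi Fw aw.
  by exists Z; split => // p s _ _; rewrite uE; exact: hZ.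
have mB j : measurable (B j) by have [] := HB j.
have mZ i : measurable (Z i) by have [] := HZ i.
pose S : set (R2 R) := chart org e1 e2 @^-1` F k.
have [mUB UB] := leb2_bigsetU_le (index_enum 'I_n) (fun j => j != k) mB.
have [mUZ UZ] := leb2_bigsetU_le (index_enum 'I_m) xpredT mZ.
have cover : S `<=` \big[setU/set0]_(j < n | j != k) B j `|` \big[setU/set0]_(i < m) Z i.
  move=> p Sp; have Pp : polyhedron a b (chart org e1 e2 p) by move: Sp;
    rewrite /S /= FkE => -[].
  have [i [s [aiu Fi s0]]] := ray_exit bP u0 Pp.
  have ai0 : a i != 0.
    by apply: contraTneq aiu => ->; rewrite dotC dot0r ltxx.
  have [d2|nd2] := pselect (has_affine_dim (face_of a b i) 2); last first.
    right; rewrite -bigcup_seq_cond; exists i; first by rewrite /= mem_index_enum.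
    by have [_ _ hZ] := HZ i; exact: (hZ p s).
  have [j FjE] := (FP _).1 (face_of_facet ai0 d2).
  (* The exit face is not [F k]: on [F k] the normals [a i] and [u] have the same direction, whereas
     the ray exits where [dot (a i) u < 0]. *)
  have jk : j != k.
    apply/negP => /eqP jk; rewrite {}jk in FjE.
    have Fi' : F k `<=` plane (a i) (b i) by rewrite -FjE => x [].
    have uai := cross_parallel ai0 (affine_dim2_parallel (dimF k) Fi' Fku).
    have := exposed_scale_gt0 P0 u0 uai Pg0 ug0 (Fi' _ Fg0).
    rewrite pmulr_lgt0 ?invr_gt0 ?dot_gt0 // => h.
    by move: aiu; rewrite ltNge (ltW h).
  left; rewrite -bigcup_seq_cond; exists j; first by rewrite /= mem_index_enum.
  have [_ _ hB] := HB j; apply: (hB u p s (a i) (b i)) => //.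
  - by rewrite -FjE => x [].
  - by rewrite lt_eqF.
  - by rewrite -FjE.
rewrite -lee_fin -Ak.
have -> : [set p | F k (org + p.1 *: e1 + p.2 *: e2)] = S by [].
apply: le_trans (_ : _ <= leb2 R (\big[setU/set0]_(j < n |
  j != k) B j `|` \big[setU/set0]_(i < m) Z i))%E _.
  apply: le_measure => //; rewrite inE; first exact: mF.
  exact: measurableU.
apply: le_trans (measureU2 _ mUB mUZ) _.
rewrite -[leRHS]adde0; apply: leeD.
  apply: le_trans UB _; rewrite -sumEFin; apply: lee_sum => j _.
  by have [] := HB j.
by apply: le_trans UZ _; rewrite big1 // => i _; have [] := HZ i.
Qed.

End Necessity.

(** * Flat polyhedra *)

Section Flat.
Variable R : realType.
Implicit Types (l r : R) (x : 'rV[R]_3).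

Lemma bounded_set_coord (P : set 'rV[R]_3) (M : R) :
  (forall x, P x -> forall i, `|x 0 i| <= M) -> bounded_set P.
Proof.
move=> h; exists (Num.max M 0); split; first exact: num_real.
move=> M' MM' x Px; have M0 : 0 <= M' by apply: le_trans (ltW MM');
  rewrite le_max lexx orbT.
rewrite /Num.norm /= mx_normrE; apply/bigmax_leP; split => // -[i j] _ /=.
rewrite ord1; apply: le_trans (h x Px j) _.
by apply: le_trans (ltW MM'); rewrite le_max lexx.
Qed.

(** Height one makes the area of this rectangle equal to its width. *)
Definition box l r : set 'rV[R]_3 :=
  [set x | [/\ l <= x 0 i0 <= r, 0 <= x 0 i1 <= 1 & x 0 i2 = 0]].

Let ex : 'rV[R]_3 := vec 1 0 0.
Let ey : 'rV[R]_3 := vec 0 1 0.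
Let ez : 'rV[R]_3 := vec 0 0 1.

Lemma box_polytope l r : convex_polytope (box l r).
Proof.
split.
  apply: (@bounded_set_coord _ (`|l| + `|r| + 1)) => x [hx hy hz].
  have := ler_norm r; have := ler_norm (- l); rewrite normrN => hl hr.
  have := normr_ge0 l; have := normr_ge0 r => r0 l0.
  by apply: ord3_ind; rewrite ?hz ?normr0 ?ler_norml; lra.
exists 6, (fun i : 'I_6 => nth 0 [:: ex; - ex; ey; - ey; ez; - ez] i),
  (fun i : 'I_6 => nth 0 [:: r; - l; 1; 0; 0; 0] i).
apply/seteqP; split => x /=.
  move=> [hx hy hz]; case=> [[|[|[|[|[|[|//]]]]]] hi] /=; vsimp; lra.
move=> h.
have := h (@Ordinal 6 0 isT); have := h (@Ordinal 6 1 isT).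
have := h (@Ordinal 6 2 isT); have := h (@Ordinal 6 3 isT).
have := h (@Ordinal 6 4 isT); have := h (@Ordinal 6 5 isT).
rewrite /= /ex /ey /ez; vsimp => h5 h4 h3 h2 h1 h0; split; lra.
Qed.

Lemma near_dot_lt (u x : 'rV[R]_3) (c : R) : dot u x < c -> nbhs x [set y | dot u y < c].
Proof.
move=> h; apply: (@open_nbhs_nbhs _ x [set y | dot u y < c]).
by split => //; exact: open_halfspace.
Qed.

Lemma box_polygon l r : l < r -> convex_polygon_in (plane ez 0) (box l r).
Proof.
move=> lr; split.
- exact: box_polytope.
- by move=> x [_ _ hz]; rewrite /plane /= /ez; vsimp; rewrite hz; ring.
exists (vec ((l + r) / 2) (2^-1) 0); set x := vec _ _ _.
have xE i : x 0 i = [:: (l + r) / 2; 2^-1; 0]`_i by rewrite /x /vec mxE.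
split; first by rewrite /plane /= /ez; vsimp; ring.
have /near_dot_lt h1 : dot ex x < r by rewrite /ex; vsimp; lra.
have /near_dot_lt h2 : dot (- ex) x < - l by rewrite /ex; vsimp; lra.
have /near_dot_lt h3 : dot ey x < 1 by rewrite /ey; vsimp; lra.
have /near_dot_lt h4 : dot (- ey) x < 0 by rewrite /ey; vsimp; lra.
change (nbhs x [set y | plane ez 0 y -> box l r y]).
have FF := nbhs_filter x.
have := @filterI _ _ FF _ _ (@filterI _ _ FF _ _ h1 h2) (@filterI _ _ FF _ _ h3 h4).
apply: (@filterS _ _ FF) => y.
rewrite /plane /ex /ey /ez /=; vsimp => -[[a1 a2] [a3 a4]] a5; split; lra.
Qed.

Lemma box_area l r : l <= r -> has_area (box l r) (r - l).
Proof.
move=> lr; exists 0, ex, ey; split; rewrite /ex /ey; try by vsimp; ring.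
  move=> x [hx hy hz]; exists (x 0 i0, x 0 i1) => //.
  by apply: eq_rV3; vsimp; rewrite ?hz; ring.
have l0 z : 0 * z + 0 <= 0 * z + 1 :> R by lra.
have [_] := leb2_trapezoid true false lr (l0 l) (l0 r).
rewrite (_ : (r - l) * _ = r - l); last by ring.
move=> <-; congr (_ _); apply/seteqP; split => p /=; rewrite /box /= in_itv /= /vec !mxE /=.
  by move=> [h1 h2 h3]; split; [move: h1|move: h2];
    rewrite !(mulr0, mulr1, mul0r, add0r, addr0).
by move=> [h1 h2]; split; move: h1 h2; rewrite !(mulr0, mulr1, mul0r, add0r, addr0).
Qed.

Lemma interior_in_move (E F : set 'rV[R]_3) x u : interior_in E F x ->
  (forall t : R, E (x + t *: u)) -> exists e : R, 0 < e /\ F (x + e *: u).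
Proof.
move=> [_ hx] hE; have [e [e0 he]] := @interior_move _ [set y | E y -> F y] x u hx.
by exists e; split => //; exact: he.
Qed.

Lemma partial_sum_itv (c : nat -> R) (N : nat) (z : R) : (0 < N)%N ->
  c 0%N <= z <= c N -> exists2 k, (k < N)%N & c k <= z <= c k.+1.
Proof.
elim: N => // N IH _ /andP[h0 h1].
have [hz|hz] := lerP (c N) z; first by exists N => //; rewrite hz.
case: N => [|N] in IH h1 hz *; first by exists 0%N => //; rewrite h0 h1.
have [//||k kN hk] := IH; first by rewrite h0 ltW.
by exists k => //; exact: ltnW.
Qed.

(** One side carries the single face [box 0 (A 1)], the other is cut into strips of widths [A 2],
    ..., [A n]. *)
Theorem flat_exists (n : nat) (A : nat -> R) : (2 <= n)%N ->
  (forall i, (1 <= i <= n)%N -> 0 < A i) -> A 1%N = \sum_(2 <= i < n.+1) A i ->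
  exists F : 'I_n -> set 'rV[R]_3, flat_polyhedron F /\
    forall i : 'I_n, has_area (F i) (A i.+1).
Proof.
move=> n2 Apos A1.
(* Here [c 1 = 0] and [c n = A 1]. Since ['I_n] starts at zero, face [i] must have area [A i.+1],
   the width of the strip from [c i] to [c i.+1]. *)
pose c k := \sum_(2 <= j < k.+1) A j.
have c1 : c 1%N = 0 by rewrite /c big_geq.
have cS k : (1 <= k)%N -> c k.+1 = c k + A k.+1.
  by move=> k1; rewrite /c big_nat_recr.
have cmono k k' : (1 <= k)%N -> (k <= k' <= n)%N -> c k <= c k'.
  move=> k1; elim: k' => [|k' IH] /andP[h1 h2].
    by move: k1 h1; case: (k).
  move: h1; rewrite leq_eqVlt => /predU1P[->//|h1].
  rewrite cS; last lia.
  rewrite ler_wpDr ?IH //; [apply/ltW/Apos; lia|lia].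
pose F (i : 'I_n) := if (i == 0 :> nat) then box 0 (A 1%N) else box (c i) (c i.+1).
have FE (i : 'I_n) : exists lo hi, [/\ F i = box lo hi, lo < hi & hi - lo = A i.+1].
  rewrite /F; case: eqP => [->|/eqP i0].
    exists 0, (A 1%N); rewrite subr0; split => //; apply: Apos; lia.
  have i1' : (0 < i)%N by rewrite lt0n.
  exists (c i), (c i.+1); rewrite cS //; split => //; last by ring.
  rewrite ltrDl; apply: Apos; have := ltn_ord i; lia.
exists F; split; last first.
  by move=> i; have [lo [hi [-> lh <-]]] := FE i; apply: box_area; exact: ltW.
exists ez, 0, (box 0 (A 1%N)), (fun i : 'I_n => i == 0 :> nat); split.
- apply/negP => /eqP/rowP/(_ i2); rewrite /ez; vsimp => /eqP; by rewrite oner_eq0.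
- apply: box_polygon; apply: Apos; lia.
- by move=> i; have [lo [hi [-> lh _]]] := FE i; exact: box_polygon.
- case; apply/seteqP; split => x.
  + by move=> [i /= i0]; rewrite /F i0.
  + have n0 : (0 < n)%N by lia.
    by move=> hx; exists (Ordinal n0) => //=; rewrite /F /=.
  + move=> [i /= i0]; rewrite /F i0 => -[/andP[h1 h2] hy hz]; split => //.
    have i1' : (0 < i)%N by lia.
    have ltin := ltn_ord i.
    have := cmono 1%N i isT _; rewrite c1 => /(_ _)h3.
    have := cmono i.+1 n isT _; rewrite A1 -/(c n) => /(_ _)h4.
    by apply/andP; split; [apply: le_trans h1; apply: h3; lia|apply: le_trans h2 _;
      apply: h4; lia].
  + move=> [hx hy hz].
    have [||k kn hk] := @partial_sum_itv (fun k => c k.+1) n.-1 (x 0 i0); first lia.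
      by rewrite c1 prednK ?/c -?A1 //; lia.
    have kn' : (k.+1 < n)%N by lia.
    by exists (Ordinal kn').
- have main (i j : 'I_n) : (0 < i)%N -> (i < j)%N ->
     interior_in (plane ez 0) (F i) `&` interior_in (plane ez 0) (F j) = set0.
    move=> ip ij; rewrite -subset0 => x [hi [_ hj]].
    have Ex : plane ez 0 x by case: hi.
    have Fjx : F j x by exact: (nbhs_singleton hj).
    (* A common interior point could be pushed to the right inside the left strip, beyond
       [c i.+1 <= c j]. *)
    have Et (t : R) : plane ez 0 (x + t *: ex).
      by move: Ex; rewrite /plane /= dotDr dotZr => ->; rewrite /ez /ex; vsimp; ring.
    have [e [e0]] := interior_in_move hi Et.
    move: Fjx; rewrite /F !gtn_eqF //; last by apply: ltn_trans ij.
    move=> [/andP[h1 _] _ _] [/andP[_ h2] _ _]; move: h2; rewrite /ex; vsimp => h2.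
    have ltjn := ltn_ord j.
    have := cmono i.+1 j isT _; rewrite ij ltnW // => /(_ isT); lra.
  move=> i j ij sij; have [i0|i0] := eqVneq (i : nat) 0%N.
    by move: sij ij; rewrite i0 eqxx -val_eqE /= i0 => /esym/eqP->; rewrite eqxx.
  have j0 : (j : nat) != 0%N by rewrite -sij.
  have := ij; rewrite -val_eqE /= neq_ltn => /orP[h|h].
    by apply: main => //; rewrite lt0n.
  by rewrite setIC; apply: main => //; rewrite lt0n.
Qed.

End Flat.

(** * Choice of the normals of the sides *)

Section Slopes.
Variable R : realType.

(** The Euclidean norm of [(r x, 1 - r)]; it deforms the constant [1] at [r = 0] into [|x|] at
    [r = 1], through branches of hyperbolas. *)
Definition hyperbola (r x : R) : R := Num.sqrt (r ^+ 2 * x ^+ 2 + (1 - r) ^+ 2).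

Lemma hyperbola_sqr r x : hyperbola r x ^+ 2 = r ^+ 2 * x ^+ 2 + (1 - r) ^+ 2.
Proof.
rewrite /hyperbola sqr_sqrtr //; apply: addr_ge0; last exact: sqr_ge0.
by apply: mulr_ge0; exact: sqr_ge0.
Qed.

Lemma hyperbola_gt0 r x : r < 1 -> 0 < hyperbola r x.
Proof.
move=> r1; rewrite /hyperbola sqrtr_gt0; apply: ltr_wpDl.
  by apply: mulr_ge0; exact: sqr_ge0.
by rewrite exprn_gt0 // subr_gt0.
Qed.

(** With denominators cleared this is the strict triangle inequality for [(r x, 1 - r)] and
    [(r z, 1 - r)] with weights [z - y] and [y - x], whose weighted sum is [z - x] times
    [(r y, 1 - r)]. *)
Lemma hyperbola_convex r x y z : 0 < r < 1 -> x < y < z ->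
  (hyperbola r y - hyperbola r x) / (y - x) < (hyperbola r z - hyperbola r y) / (z - y).
Proof.
move=> /andP[r0 r1] /andP[xy yz].
set gx := hyperbola r x; set gy := hyperbola r y; set gz := hyperbola r z.
have gx0 : 0 < gx by exact: hyperbola_gt0.
have gy0 : 0 < gy by exact: hyperbola_gt0.
have gz0 : 0 < gz by exact: hyperbola_gt0.
have hx : gx ^+ 2 = _ := hyperbola_sqr r x.
have hy : gy ^+ 2 = _ := hyperbola_sqr r y.
have hz : gz ^+ 2 = _ := hyperbola_sqr r z.
have xz : x < z by exact: lt_trans yz.
have r1' : 0 < (1 - r) ^+ 2 by rewrite exprn_gt0 // subr_gt0.
have r2' : 0 < r ^+ 2 by rewrite exprn_gt0.
(* Strict Cauchy-Schwarz for the vectors (r x, 1 - r) and (r z, 1 - r). *)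
have CS : r ^+ 2 * x * z + (1 - r) ^+ 2 < gx * gz.
  rewrite ltNge; apply/negP => h.
  have : (gx * gz) ^+ 2 <= (r ^+ 2 * x * z + (1 - r) ^+ 2) ^+ 2.
    by rewrite ler_pXn2r // nnegrE; [apply: mulr_ge0; exact: ltW|apply: le_trans h;
      apply: mulr_ge0; exact: ltW].
  rewrite exprMn hx hz -subr_le0.
  have -> : (r ^+ 2 * x ^+ 2 + (1 - r) ^+ 2) * (r ^+ 2 * z ^+ 2 + (1 - r) ^+ 2) -
     (r ^+ 2 * x * z + (1 - r) ^+ 2) ^+ 2 = r ^+ 2 * (1 - r) ^+ 2 * (z - x) ^+ 2 by ring.
  have pos : 0 < r ^+ 2 * (1 - r) ^+ 2 * (z - x) ^+ 2.
    by apply: mulr_gt0; [exact: mulr_gt0|rewrite exprn_gt0 // subr_gt0].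
  by rewrite leNgt pos.
rewrite ltr_pdivrMr ?subr_gt0 // mulrAC ltr_pdivlMr ?subr_gt0 //.
suff : gy * (z - x) < gx * (z - y) + gz * (y - x) by lra.
have p1 : 0 < z - y by rewrite subr_gt0.
have p2 : 0 < y - x by rewrite subr_gt0.
have p3 : 0 < z - x by rewrite subr_gt0.
rewrite -(@ltr_pXn2r _ 2) // ?nnegrE; last 2 first.
- by apply: mulr_ge0; exact: ltW.
- by apply: addr_ge0; apply: mulr_ge0; exact: ltW.
rewrite exprMn hy.
have -> : (gx * (z - y) + gz * (y - x)) ^+ 2 =
  gx ^+ 2 * (z - y) ^+ 2 + gz ^+ 2 * (y - x) ^+ 2
   + 2 * ((z - y) * (y - x)) * (gx * gz) by ring.
rewrite hx hz.
have := mulr_gt0 p1 p2; set pp := (z - y) * (y - x) => pp0.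
have : 0 < 2 * pp * (gx * gz - (r ^+ 2 * x * z + (1 - r) ^+ 2)).
  by apply: mulr_gt0; [exact: mulr_gt0|rewrite subr_gt0].
rewrite /pp => h; rewrite -subr_gt0; move: h; congr (_ < _); ring.
Qed.

(** Reverse triangle inequality: the numerator is at most [r (y - x)] in absolute value. *)
Lemma hyperbola_lipschitz r x y : 0 <= r < 1 -> x < y ->
  `|(hyperbola r y - hyperbola r x) / (y - x)| < 1.
Proof.
move=> /andP[r0 r1] xy.
set gx := hyperbola r x; set gy := hyperbola r y.
have gx0 : 0 < gx by exact: hyperbola_gt0.
have gy0 : 0 < gy by exact: hyperbola_gt0.
have hx : gx ^+ 2 = _ := hyperbola_sqr r x.
have hy : gy ^+ 2 = _ := hyperbola_sqr r y.
have p : 0 < y - x by rewrite subr_gt0.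
have r1' : 0 < (1 - r) ^+ 2 by rewrite exprn_gt0 // subr_gt0.
rewrite normrM normfV [`|y - x|]gtr0_norm // ltr_pdivrMr // mul1r.
rewrite -(@ltr_pXn2r _ 2) ?nnegrE ?(ltW p) // real_normK ?num_real //.
have CS : r ^+ 2 * x * y + (1 - r) ^+ 2 <= gx * gy.
  have [n|n] := lerP (r ^+ 2 * x * y + (1 - r) ^+ 2) 0.
    by apply: le_trans n _; apply: mulr_ge0; exact: ltW.
  rewrite -(@ler_pXn2r _ 2) ?nnegrE ?(ltW n) // ?mulr_ge0 ?(ltW gx0) ?(ltW gy0) //.
  rewrite exprMn hx hy -subr_ge0.
  have -> : (r ^+ 2 * x ^+ 2 + (1 - r) ^+ 2) * (r ^+ 2 * y ^+ 2 + (1 - r) ^+ 2) -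
     (r ^+ 2 * x * y + (1 - r) ^+ 2) ^+ 2 = r ^+ 2 * (1 - r) ^+ 2 * (y - x) ^+ 2 by ring.
  by apply: mulr_ge0; [apply: mulr_ge0|]; exact: sqr_ge0.
have E : (gy - gx) ^+ 2 = gy ^+ 2 + gx ^+ 2 - 2 * (gx * gy) by ring.
rewrite E hx hy.
have r2 : r ^+ 2 < 1 by rewrite expr_lt1.
have : 0 < (1 - r ^+ 2) * (y - x) ^+ 2 by rewrite mulr_gt0 ?subr_gt0 // exprn_gt0.
have -> : (1 - r ^+ 2) * (y - x) ^+ 2 = (y - x) ^+ 2 - r ^+ 2 * (y - x) ^+ 2 by ring.
have -> : r ^+ 2 * (y - x) ^+ 2 =
  r ^+ 2 * x ^+ 2 + r ^+ 2 * y ^+ 2 - 2 * (r ^+ 2 * x * y) by ring.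
lra.
Qed.

Lemma hyperbola1 x : hyperbola 1 x = `|x|.
Proof. by rewrite /hyperbola subrr expr0n addr0 expr1n mul1r sqrtr_sqr. Qed.

Lemma hyperbola0 x : hyperbola 0 x = 1.
Proof. by rewrite /hyperbola expr0n mul0r add0r subr0 expr1n sqrtr1. Qed.

Lemma continuous_hyperbola x : continuous (hyperbola^~ x).
Proof.
move=> r; rewrite /hyperbola.
apply: (@continuous_comp _ _ _ (fun r : R => r ^+ 2 * x ^+ 2 + (1 - r) ^+ 2) (@Num.sqrt R)).
  apply: cvgD.
    apply: cvgM; last exact: cvg_cst.
    by apply: cvgM; exact: cvg_id.
  by apply: cvgM; (apply: cvgB; [exact: cvg_cst|exact: cvg_id]).
exact: sqrt_continuous.
Qed.

(** The pairs [(sqrt (1 - s k ^+ 2), s k)] will be the unit normals of the sides, and [lo < hi] will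
    be the difference and the sum of the cap areas. The intermediate value theorem is applied in the
    parameter [r]. *)
Lemma slopes_exist (m : nat) (a : nat -> R) (lo hi : R) : (2 <= m)%N ->
  (forall k, (k < m)%N -> 0 < a k) ->
  (forall k, (k < m)%N -> a k < hi) -> lo < hi ->
  lo < \sum_(k < m) a k ->
  exists s : nat -> R, [/\ forall k, (k < m)%N -> -1 < s k < 1,
    forall k l, (k < l)%N -> (l < m)%N -> s k < s l,
    \sum_(k < m) a k * s k = 0 &
    lo < \sum_(k < m) a k * Num.sqrt (1 - s k ^+ 2) < hi].
Proof.
move=> m2 a0 ahi lohi loS.
pose S k := \sum_(j < k) a j.
have SS k : S k.+1 = S k + a k by rewrite /S big_ord_recr.
have S0 : S 0%N = 0 by rewrite /S big_ord0.
have Slt k : (k < m)%N -> S k < S k.+1 by move=> km; rewrite SS ltrDl a0.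
have Smon k l : (k < l)%N -> (l <= m)%N -> S k < S l.
  elim: l => // l IH; rewrite ltnS leq_eqVlt => /predU1P[->|kl] lm; first exact: Slt.
  by apply: lt_trans (Slt l lm); apply: IH => //; exact: ltnW.
have Sle k l : (k <= l)%N -> (l <= m)%N -> S k <= S l.
  by rewrite leq_eqVlt => /predU1P[->//|kl lm]; apply/ltW/Smon.
(* Shifting by [H] makes the ends of the subdivision opposite, so that the telescoping sum vanishes
   by evenness. *)
pose H := S m / 2.
pose s r k := (hyperbola r (S k.+1 - H) - hyperbola r (S k - H)) / a k.
have sE r k : s r k = (hyperbola r (S k.+1 - H) - hyperbola r (S k - H)) /
  (S k.+1 - H - (S k - H)).
  by rewrite /s SS; congr (_ / _); ring.
have sum0 r : \sum_(k < m) a k * s r k = 0.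
  transitivity (\sum_(k < m) (hyperbola r (S k.+1 - H) - hyperbola r (S k - H))).
    apply: eq_bigr => k _; rewrite /s mulrC divfK // gt_eqF // a0 //.
  rewrite -(big_mkord xpredT (fun k => hyperbola r (S k.+1 - H) - hyperbola r (S k - H))).
  rewrite (telescope_sumr (fun k => hyperbola r (S k - H))) // S0 /hyperbola.
  have -> : S m - H = - (0 - H) by rewrite /H; field.
  by rewrite sqrrN subrr.
pose T r := \sum_(k < m) a k * Num.sqrt (1 - s r k ^+ 2).
have T0 : T 0 = S m.
  rewrite /T /S; apply: eq_bigr => k _.
  by rewrite /s !hyperbola0 subrr mul0r expr0n subr0 sqrtr1 mulr1.
(* The [k]-th interval contains the centre. At [r = 1] every other quotient is a slope of [|x|] on
   one side of zero, hence [1] or [-1], and its term in [T 1] is zero. *)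
have [k km /andP[k1 k2]] : exists2 k, (k < m)%N & S k <= H <= S k.+1.
  apply: partial_sum_itv; first lia.
  have := Smon 0%N m _ (leqnn m); rewrite S0 => /(_ _)Sm; rewrite /H.
  by have : 0 < S m by [apply: Sm; lia]; lra.
have T1 : T 1 <= a k.
  rewrite /T (bigD1 (Ordinal km)) //= big1 ?addr0.
    rewrite -[leRHS]mulr1 ler_pM2l ?a0 // -[leRHS]sqrtr1 ler_wsqrtr //.
    by rewrite gerBl sqr_ge0.
  move=> j; rewrite -val_eqE /= neq_ltn => jk; rewrite /s !hyperbola1.
  have aj : a j != 0 by rewrite gt_eqF // a0.
  have := ltn_ord j => jm.
  suff -> : ((`|S j.+1 - H| - `|S j - H|) / a j) ^+ 2 = 1 by rewrite subrr sqrtr0 mulr0.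
  have := Slt j jm => Sj.
  case/orP: jk => jk.
    have := Sle _ _ jk (ltnW km) => h.
    rewrite !ler0_norm ?subr_le0; try lra.
    by rewrite (_ : (_ - _) / _ = -1) ?sqrrN ?expr1n // SS; field.
  have := Sle _ _ jk (ltnW jm) => h.
  rewrite !ger0_norm ?subr_ge0; try lra.
  by rewrite (_ : (_ - _) / _ = 1) ?expr1n // SS; field.
have cT : continuous T.
  apply: (@continuous_big _ _ +%R 0 xpredT); first exact: add_continuous.
  move=> j _ r; apply: cvgM; first exact: cvg_cst.
  apply: (@continuous_comp _ _ _ (fun r : R => 1 - s r j ^+ 2) (@Num.sqrt R));
    last exact: sqrt_continuous.
  have cs : {for r, continuous (s^~ j)}.
    apply: cvgM; last exact: cvg_cst.
    by apply: cvgB; exact: continuous_hyperbola.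
  apply: cvgB; first exact: cvg_cst.
  by apply: cvgM; exact: cs.
have akS : a k < S m.
  have [j [jm jk]] : exists j, (j < m)%N /\ j != k.
    by case: (k) => [|k']; [exists 1%N|exists 0%N]; split => //; lia.
  rewrite /S (bigD1 (Ordinal km)) //= ltrDl (bigD1 (Ordinal jm)) /=;
    last by rewrite -val_eqE.
  by rewrite ltr_pwDl ?a0 // sumr_ge0 // => i _; rewrite ltW // a0.
(* Strictly between [T 1] and [T 0], so that the parameter found is neither [0] nor [1], as strict
   convexity and slopes below one require. *)
have [v [v1 v2 v3 v4]] : exists v, [/\ lo < v, v < hi, T 1 < v & v < T 0].
  exists ((Num.max lo (T 1) + Num.min hi (T 0)) / 2).
  have h : Num.max lo (T 1) < Num.min hi (T 0).
    rewrite gt_max !lt_min lohi T0 loS /=.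
    by rewrite (le_lt_trans T1 (ahi _ km)) (le_lt_trans T1 akS).
  have l1 : lo <= Num.max lo (T 1) by rewrite le_max lexx.
  have l2 : T 1 <= Num.max lo (T 1) by rewrite le_max lexx orbT.
  have l3 : Num.min hi (T 0) <= hi by rewrite ge_min lexx.
  have l4 : Num.min hi (T 0) <= T 0 by rewrite ge_min lexx orbT.
  by split; lra.
have [r r01 Tr] : exists2 r, r \in `[0, 1] & T r = v.
  apply: IVT => //; first exact: continuous_subspaceT.
  by rewrite ge_min le_max (ltW v3) (ltW v4) orbT.
have r01' : 0 < r < 1.
  move: r01; rewrite in_itv /= !le_eqVlt => /andP[/predU1P[r0|->] /predU1P[r1|->]] //.
  - by move: v4; rewrite -Tr -r0 ltxx.
  - by move: v4; rewrite -Tr -r0 ltxx.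
  - by move: v3; rewrite -Tr r1 ltxx.
exists (s r); split => //.
- move=> j jm; rewrite -ltr_norml sE; apply: hyperbola_lipschitz.
    by case/andP: r01' => /ltW-> ->.
  by rewrite ltrD2r; exact: Slt.
- move=> i j ij jm.
  have step q : (q.+1 < m)%N -> s r q < s r q.+1.
    move=> qm; rewrite !sE; apply: hyperbola_convex => //.
    by rewrite !ltrD2r !Slt //; exact: ltnW.
  elim: j ij jm => // j IH; rewrite ltnS leq_eqVlt => /predU1P[->|ij] jm; first exact: step.
  by apply: lt_trans (step j jm); apply: IH => //; exact: ltnW.
- by rewrite -/(T r) Tr v1 v2.
Qed.

End Slopes.

(** * Wedges *)

Section Chain.
Variables (R : realType) (m : nat) (a s : nat -> R) (c : R).

(* A convex polygonal chain whose [k]-th edge has unit normal [(kap k, s k)],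
   length [elen k], and goes from [(vtx k, vty k)] to [(vtx k.+1, vty k.+1)].
   The formula for [vtx] is forced by the requirement that [c] times the
   integral of the first coordinate along the [k]-th edge be [a k]. *)
Definition kap k := Num.sqrt (1 - s k ^+ 2).
Definition vtx k := Num.sqrt (- (2 / c) * \sum_(0 <= j < k) a j * s j).
Definition elen k := 2 * a k / (c * (vtx k + vtx k.+1)).
Definition vty k := \sum_(0 <= j < k) elen j * kap j.
Definition eoff k := kap k * vtx k + s k * vty k.

Hypothesis m2 : (2 <= m)%N.
Hypothesis a0 : forall k, (k < m)%N -> 0 < a k.
Hypothesis s1 : forall k, (k < m)%N -> -1 < s k < 1.
Hypothesis smon : forall k l, (k < l)%N -> (l < m)%N -> s k < s l.
Hypothesis s0 : \sum_(0 <= k < m) a k * s k = 0.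
Hypothesis c0 : 0 < c.

Let cn0 : c != 0. Proof. by rewrite gt_eqF. Qed.

Lemma kap_gt0 k : (k < m)%N -> 0 < kap k.
Proof.
move=> km; rewrite /kap sqrtr_gt0 subr_gt0 -(real_normK (num_real _)).
by rewrite expr_lt1 // ltr_norml s1.
Qed.

Lemma kap_sqr k : (k < m)%N -> kap k ^+ 2 = 1 - s k ^+ 2.
Proof.
move=> /kap_gt0; rewrite /kap sqrtr_gt0 => /ltW; exact: sqr_sqrtr.
Qed.

(** The sine of the angle from the [k]-th to the [l]-th normal; both normals lie in the open right
    half-plane, where the angle grows with [s]. *)
Lemma turn k l : (k < l)%N -> (l < m)%N -> 0 < kap k * s l - s k * kap l.
Proof.
move=> kl lm; have km : (k < m)%N by exact: ltn_trans lm.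
have skl := smon kl lm; have k0 := kap_gt0 km; have l0 := kap_gt0 lm.
have [sk|sk] := lerP 0 (s k).
  have kk : kap l <= kap k.
    by rewrite /kap ler_wsqrtr // lerD2l lerN2 ler_pXn2r ?nnegrE //; lra.
  have := ler_wpM2l sk kk; have : kap k * s k < kap k * s l by rewrite ltr_pM2l.
  lra.
have [sl|sl] := lerP (s l) 0.
  have kk : kap k <= kap l.
    by rewrite /kap ler_wsqrtr // lerD2l lerN2 -[s l ^+ 2]sqrrN -[s k ^+ 2]sqrrN ler_pXn2r ?nnegrE //; lra.
  have : s k * kap l <= s k * kap k by rewrite ler_nM2l.
  have : kap k * s k < kap k * s l by rewrite ltr_pM2l.
  lra.
have : 0 < kap k * s l by exact: mulr_gt0.
have : s k * kap l < 0 by rewrite nmulr_rlt0.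
lra.
Qed.

(** As [s] increases, the terms change sign at most once, from negative to positive; with total
    zero, a proper nonempty initial sum is negative. *)
Lemma sum_lt0 k : (0 < k < m)%N -> \sum_(0 <= j < k) a j * s j < 0.
Proof.
move=> /andP[k0 km].
have [sk|sk] := ltrP (s k.-1) 0.
  have neg j : (0 <= j < k)%N -> a j * s j < 0.
    move=> /andP[_ jk]; rewrite pmulr_rlt0; last by apply: a0; lia.
    have [->//|jk'] := eqVneq j k.-1.
    by apply: lt_trans sk; apply: smon; lia.
  by have := ltr_sum_nat k0 neg; rewrite [ltRHS]big1.
have pos j : (k <= j < m)%N -> 0 < a j * s j.
  move=> /andP[kj jm]; rewrite mulr_gt0 ?a0 //.
  by apply: le_lt_trans sk _; apply: smon; lia.
move: s0; rewrite (big_cat_nat (n := k)) //=; last exact: ltnW.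
by have := ltr_sum_nat km pos; rewrite [ltLHS]big1 //; lra.
Qed.

Lemma vtx0 : vtx 0 = 0. Proof. by rewrite /vtx big_geq // mulr0 sqrtr0. Qed.
Lemma vtxm : vtx m = 0. Proof. by rewrite /vtx s0 mulr0 sqrtr0. Qed.
Lemma vtx_ge0 k : 0 <= vtx k. Proof. exact: sqrtr_ge0. Qed.

Lemma vtx_gt0 k : (0 < k < m)%N -> 0 < vtx k.
Proof.
move=> /sum_lt0 hk; rewrite /vtx sqrtr_gt0 mulNr oppr_gt0 pmulr_rlt0 //.
by rewrite divr_gt0.
Qed.

Lemma vtx_sqr k : (k <= m)%N -> vtx k ^+ 2 = - (2 / c) * \sum_(0 <= j < k) a j * s j.
Proof.
move=> km; have [k0|k0] := posnP k; first by rewrite k0 vtx0 big_geq // mulr0 expr0n.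
move: km; rewrite leq_eqVlt => /predU1P[->|km]; first by rewrite vtxm s0 mulr0 expr0n.
have /vtx_gt0 : (0 < k < m)%N by rewrite k0.
by rewrite /vtx sqrtr_gt0 => /ltW; exact: sqr_sqrtr.
Qed.

Lemma vtxD_gt0 k : (k < m)%N -> 0 < vtx k + vtx k.+1.
Proof.
move=> km; have [k0|k0] := posnP k.
  by rewrite ltr_wpDl ?vtx_ge0 // vtx_gt0 // k0; lia.
by rewrite ltr_pwDl ?vtx_ge0 // vtx_gt0 // k0.
Qed.

Lemma elen_gt0 k : (k < m)%N -> 0 < elen k.
Proof.
by move=> km; rewrite /elen; apply: divr_gt0; apply: mulr_gt0; rewrite ?a0 ?vtxD_gt0.
Qed.

(** Factor the difference of the squares of the two coordinates, which is [- 2 a k s k / c]. *)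
Lemma vtxS k : (k < m)%N -> vtx k.+1 = vtx k - elen k * s k.
Proof.
move=> km; have d0 := vtxD_gt0 km.
have := vtx_sqr km; rewrite big_nat_recr //= mulrDr -vtx_sqr; last exact: ltnW.
move=> E; have n0 : vtx k + vtx k.+1 != 0 by rewrite gt_eqF.
apply: (mulIf n0).
transitivity (vtx k * vtx k.+1 + vtx k.+1 ^+ 2); first by ring.
rewrite E /elen; field.
by rewrite n0.
Qed.

Lemma vtyS k : vty k.+1 = vty k + elen k * kap k.
Proof. by rewrite /vty big_nat_recr. Qed.

Lemma vty_lt k l : (k < l)%N -> (l <= m)%N -> vty k < vty l.
Proof.
elim: l => // l IH; rewrite ltnS leq_eqVlt => kl lm.
have lt : vty l < vty l.+1 by rewrite vtyS ltrDl mulr_gt0 ?elen_gt0 ?kap_gt0.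
move: kl => /predU1P[->//|kl].
by apply: lt_trans lt; apply: IH => //; exact: ltnW.
Qed.

Lemma eoffE k : (k < m)%N -> eoff k = kap k * vtx k.+1 + s k * vty k.+1.
Proof. by move=> km; rewrite /eoff vtxS // vtyS; ring. Qed.

(** Convexity of the chain: by [turn], the linear form of the [k]-th normal increases along the
    edges before the [k]-th and decreases along those after it. *)
Lemma vertex_le k j : (k < m)%N -> (j <= m)%N -> kap k * vtx j + s k * vty j <= eoff k.
Proof.
move=> km; pose g j := kap k * vtx j + s k * vty j; rewrite -/(g j).
have gS i : (i < m)%N -> g i.+1 = g i + elen i * (s k * kap i - kap k * s i).
  by move=> im; rewrite /g vtxS // vtyS; ring.
move=> jm; have [jk|kj] := leqP j k.
  have up i : (i + j <= k)%N -> g j <= g (i + j)%N.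
    elim: i => // i IH hi; apply: le_trans (IH _) _; first lia.
    rewrite addSn gS; last lia.
    rewrite lerDl mulr_ge0 ?(ltW (elen_gt0 _)) //; first lia.
    have ijk : (i + j < k)%N by [].
    by have := turn ijk km; rewrite mulrC [kap k * _]mulrC; lra.
  by have := up (k - j)%N; rewrite subnK // => /(_ (leqnn _)).
have down i : (i + k.+1 <= m)%N -> g (i + k.+1)%N <= g k.+1.
  elim: i => // i IH hi; apply: le_trans (IH _); last lia.
  rewrite addSn gS; last lia.
  rewrite gerDl pmulr_rle0 ?elen_gt0 //.
  have kik : (k < i + k.+1)%N by lia.
  by have := turn kik hi; lra.
by rewrite eoffE //; have := down (j - k.+1)%N; rewrite subnK //; apply.
Qed.

(** The point of the [k]-th edge at height [y] is a convex combination of two vertices, hence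
    satisfies all constraints; so does every point to its left, since all [kap j] are positive. *)
Lemma strip_le k x y : (k < m)%N -> vty k <= y <= vty k.+1 ->
  kap k * x + s k * y <= eoff k ->
  forall j, (j < m)%N -> kap j * x + s j * y <= eoff j.
Proof.
move=> km /andP[y1 y2] hx j jm.
have Yk : 0 < vty k.+1 - vty k by rewrite subr_gt0 vty_lt.
pose t := (y - vty k) / (vty k.+1 - vty k).
have yE : y = vty k + t * (vty k.+1 - vty k) by rewrite /t divfK ?gt_eqF //; ring.
have t0 : 0 <= t by apply: divr_ge0; [rewrite subr_ge0|exact: ltW].
have t1 : 0 <= 1 - t by rewrite subr_ge0 ler_pdivrMr // mul1r; lra.
pose xk := vtx k + t * (vtx k.+1 - vtx k).
have xx : x <= xk.
  have k0 := kap_gt0 km.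
  rewrite -(ler_pM2l k0); have hk := eoffE km.
  have : kap k * xk + s k * y = (1 - t) * eoff k + t * eoff k.
    by rewrite {2}hk /eoff /xk yE; ring.
  by lra.
have j0 := kap_gt0 jm.
apply: (@le_trans _ _ (kap j * xk + s j * y)); first by rewrite lerD2r ler_pM2l.
have -> : kap j * xk + s j * y = (1 - t) * (kap j * vtx k + s j * vty k) +
   t * (kap j * vtx k.+1 + s j * vty k.+1) by rewrite /xk yE; ring.
have := ler_wpM2l t1 (vertex_le jm (ltnW km)).
have := ler_wpM2l t0 (vertex_le jm km).
lra.
Qed.

(** The chain starts and ends on [x = 0]; its first edge has [s < 0] and bounds [y] from below, its
    last has [s > 0] and bounds [y] from above. *)
Lemma chain_bounds x y : 0 <= x -> (forall k, (k < m)%N -> kap k * x + s k * y <= eoff k) ->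
  vty 0 <= y <= vty m.
Proof.
move=> x0 hx.
have s00 : s 0%N < 0.
  have /sum_lt0 : (0 < 1 < m)%N by lia.
  by rewrite big_nat1 pmulr_rlt0 // a0 //; lia.
have sm : 0 < s m.-1.
  have /sum_lt0 : (0 < m.-1 < m)%N by lia.
  have E : m = m.-1.+1 by lia.
  move: s0; rewrite {1}E big_nat_recr //= => E1 h1.
  have : 0 < a m.-1 * s m.-1 by lra.
  by rewrite pmulr_rgt0 // a0 //; lia.
have m0 : (0 < m)%N by lia.
have mm : (m.-1 < m)%N by lia.
apply/andP; split.
  have := hx 0%N m0; rewrite /eoff vtx0 mulr0 add0r => h1.
  have := mulr_ge0 (ltW (kap_gt0 m0)) x0 => h2.
  by rewrite -(ler_nM2l s00); lra.
have := hx m.-1 mm; rewrite eoffE // prednK // vtxm mulr0 add0r => h1.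
have := mulr_ge0 (ltW (kap_gt0 mm)) x0 => h2.
by rewrite -(ler_pM2l sm); lra.
Qed.

(** [p] is arc length on the line of the [k]-th edge. The neighbouring edges bound it by [turn]; at
    the ends of the chain [chain_bounds] takes over. *)
Lemma edge_bounds k p x y : (k < m)%N -> 0 <= x ->
  (forall k, (k < m)%N -> kap k * x + s k * y <= eoff k) ->
  x = vtx k - s k * p -> y = vty k + kap k * p -> 0 <= p <= elen k.
Proof.
move=> km x0 hx xE yE; have /andP[y1 y2] := chain_bounds x0 hx.
have k0 := kap_gt0 km.
apply/andP; split.
  have [kz|kp] := posnP k.
    rewrite -(pmulr_rge0 _ k0); move: y1; rewrite yE kz; lra.
  have km1 : (k.-1 < m)%N by lia.
  have /turn/(_ km) tu : (k.-1 < k)%N by lia.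
  rewrite -(pmulr_rge0 _ tu).
  by have := hx k.-1 km1; rewrite eoffE // prednK // xE yE; lra.
have [kz|kp] := eqVneq k.+1 m.
  rewrite -(ler_pM2l k0); move: y2; rewrite yE -kz vtyS; lra.
have km1 : (k.+1 < m)%N by lia.
have tu := turn (leqnn k.+1) km1.
rewrite -(ler_pM2l tu).
by have := hx k.+1 km1; rewrite /eoff vtxS // vtyS xE yE; lra.
Qed.

Variables (al ga : R).
Hypothesis cE : al + ga = c.

(** The base, stretched by [q] in its first coordinate, is the disjoint union of its lowest vertex
    and one half-open trapezoid per edge. *)
Lemma stripsE (q y z : R) : 0 < q ->
  0 <= z / q /\ (forall k, (k < m)%N -> kap k * (z / q) + s k * y <= eoff k) <->
  ((y = vty 0 /\ z = 0) \/ exists2 k, (k < m)%N &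
    vty k < y <= vty k.+1 /\ 0 <= z <= - (q * s k / kap k) * y + q * eoff k / kap k).
Proof.
move=> q0.
have hk k : (k < m)%N -> (z <= - (q * s k / kap k) * y + q * eoff k / kap k) =
   (kap k * (z / q) + s k * y <= eoff k).
  move=> km; have k0 := kap_gt0 km.
  have -> : - (q * s k / kap k) * y + q * eoff k / kap k =
    (eoff k - s k * y) * (q / kap k) by ring.
  rewrite -ler_pdivrMr ?divr_gt0 // invf_div lerBrDr; congr (_ + _ <= _).
  by ring.
have z0 : (0 <= z / q) = (0 <= z) by rewrite pmulr_lge0 // invr_gt0.
have m0 : (0 < m)%N by lia.
split.
  move=> [zq hz]; have /andP[y1 y2] := chain_bounds zq hz.
  move: y1; rewrite le_eqVlt => /predU1P[yE|y1].
    left; split=> //; have := hz 0%N m0; rewrite -yE /eoff vtx0 mulr0 add0r => h1.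
    have := kap_gt0 m0 => k0.
    have : kap 0 * (z / q) <= 0 by lra.
    rewrite pmulr_rle0 // => h2.
    have : z / q = 0 by lra.
    by move/eqP; rewrite mulf_eq0 invr_eq0 [q == 0]gt_eqF // orbF => /eqP.
  right.
  have [k km yk] : exists2 k, (k < m)%N & vty k < y <= vty k.+1.
    have: forall N, (N <= m)%N -> y <= vty N ->
      exists2 k, (k < N)%N & vty k < y <= vty k.+1.
      elim => [|N IH] Nm yN; first by move: y1; rewrite ltNge yN.
      have [yN'|yN'] := lerP y (vty N).
        by have [k kN hk'] := IH (ltnW Nm) yN'; exists k => //; exact: ltnW.
      by exists N => //; rewrite yN' yN.
    by move=> /(_ m (leqnn _) y2).
  by exists k => //; split => //; rewrite hk // hz // -z0 zq.
case=> [[-> ->]|[k km [/andP[y1 y2] /andP[z1 z2]]]].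
  rewrite mul0r; split => // k km; have := vertex_le km (leq0n m).
  by rewrite vtx0.
split; first by rewrite z0.
apply: (strip_le km); first by rewrite (ltW y1).
by rewrite -hk.
Qed.

(** The [k]-th trapezoid has width [elen k * kap k] and mean height [q * (vtx k + vtx k.+1) / 2];
    the choice of [elen] turns the product into [q * a k * kap k / c]. *)
Lemma strips_area (q : R) : 0 < q ->
  leb2 R [set p : R2 R | 0 <= p.2 / q /\ forall k, (k < m)%N ->
    kap k * (p.2 / q) + s k * p.1 <= eoff k]
  = (q * (\sum_(0 <= k < m) a k * kap k) / c)%:E.
Proof.
move=> q0.
pose N : set (R2 R) := [set p | p.1 = vty 0 /\ p.2 = 0].
pose T k : set (R2 R) := [set p | p.1 \in Interval (BRight (vty k)) (BRight (vty k.+1)) /\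
  0 * p.1 + 0 <= p.2 <= - (q * s k / kap k) * p.1 + q * eoff k / kap k].
have hT k : (k < m)%N -> measurable (T k) /\ leb2 R (T k) = (q * (a k * kap k) / c)%:E.
  move=> km; have k0 := kap_gt0 km; have kn0 : kap k != 0 by rewrite gt_eqF.
  have le x v : 0 <= v -> eoff k = kap k * v + s k * x ->
     0 * x + 0 <= - (q * s k / kap k) * x + q * eoff k / kap k.
    move=> v0 ->; have -> : - (q * s k / kap k) * x + q * (kap k * v +
      s k * x) / kap k = q * v by field.
    by rewrite mul0r addr0 mulr_ge0 // ltW.
  have [mT ->] := leb2_trapezoid false false (ltW (vty_lt (ltnSn k) km))
    (le _ _ (vtx_ge0 k) (erefl _)) (le _ _ (vtx_ge0 k.+1) (eoffE km)).
  split => //; congr EFin.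
  have -> : (vty k.+1 - vty k) * ((- (q * s k / kap k) - 0) * (vty k + vty k.+1) / 2 +
    (q * eoff k / kap k - 0)) =
    (vty k.+1 - vty k) * q / kap k * ((eoff k + eoff k) / 2 - s k * (vty k +
      vty k.+1) / 2) by field.
  rewrite {2}(eoffE km) /eoff vtyS /elen; have := vtxD_gt0 km => xx; field.
  by rewrite kn0 cn0 gt_eqF.
have mN : measurable N.
  have -> : N = [set p : R2 R | 1 * p.1 + 0 * p.2 =
    vty 0] `&` [set p : R2 R | 0 * p.1 + 1 * p.2 = 0].
    apply/seteqP; split => p /=; rewrite /N /= !mul1r !mul0r addr0 add0r //.
  by apply: measurableI; exact: measurable_line.
have N0 : leb2 R N = 0%E.
  have mA : measurable [set p : R2 R | 1 * p.1 + 0 * p.2 = vty 0] by exact: measurable_line.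
  have n1 : ((1 : R) != 0) || ((0 : R) != 0) by rewrite oner_eq0.
  have := leb2_line (vty 0) n1; set A := [set p | _] => A0.
  apply: (@subset_measure0 _ _ _ (leb2 R) N A) => //.
  by move=> p [p1 p2]; rewrite /A /= p1 p2; ring.
pose U k := N `|` [set p : R2 R | exists2 j, (j < k)%N & T j p].
have US k : U k.+1 = U k `|` T k.
  apply/seteqP; split => p /=.
    move=> [pN|[j]]; first by left; left.
    rewrite ltnS leq_eqVlt => /predU1P[->|jk] Tj; first by right.
    by left; right; exists j.
  move=> [[pN|[j jk Tj]]|Tk]; first by left.
    by right; exists j => //; exact: ltnW.
  by right; exists k.
have hU k : (k <= m)%N -> measurable (U k) /\ leb2 R (U k) =
  (\sum_(0 <= j < k) q * (a j * kap j) / c)%:E.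
  elim: k => [_|k IH km].
    have -> : U 0%N = N.
      by apply/seteqP; split => p; [case=> // -[]|left].
    by rewrite big_geq.
  have [mU EU] := IH (ltnW km); have [mT ET] := hT k km.
  rewrite US; split; first exact: measurableU.
  rewrite measureU //; first by rewrite big_nat_recr //= EFinD -EU -ET.
  rewrite -subset0 => p [Up [pk _]].
  move: pk; rewrite in_itv /= => /andP[pk _].
  have : p.1 <= vty k.
    case: Up => [[-> _]|[j jk [pj _]]].
      by have [->//|k0] := posnP k; rewrite ltW // vty_lt // ltnW.
    move: pj; rewrite in_itv /= => /andP[_ pj]; apply: le_trans pj _.
    by move: jk; rewrite leq_eqVlt => /predU1P[->//|jk]; rewrite ltW // vty_lt // ltnW.
  by rewrite leNgt pk.
have [_] := hU m (leqnn m).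
rewrite (_ : \sum_(0 <= j < m) _ = q * (\sum_(0 <= k < m) a k * kap k) / c); last first.
  by rewrite mulr_sumr mulr_suml.
move=> <-; congr (leb2 R _); apply/seteqP; split => p /=.
  move/(stripsE _ _ q0) => [pN|[k km [pk pz]]]; first by left.
  by right; exists k => //; split; rewrite ?in_itv //= mul0r addr0.
move=> [pN|[k km [pk pz]]]; apply/(stripsE _ _ q0); first by left.
right; exists k => //; split; first by move: pk; rewrite in_itv.
by move: pz; rewrite mul0r addr0.
Qed.

(** A slope [be] stretches the [x]-direction by [q = sqrt (1 + be^2)]; the frame consists of the
    [y]-direction and the direction of steepest ascent or descent. *)
Lemma cap_area (be : R) (F : set 'rV[R]_3) :
  (forall x, F x <-> [/\ x 0 i2 = be * x 0 i0, 0 <= x 0 i0 &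
     forall k, (k < m)%N -> kap k * x 0 i0 + s k * x 0 i1 <= eoff k]) ->
  has_area F (Num.sqrt (1 + be ^+ 2) * (\sum_(0 <= k < m) a k * kap k) / c).
Proof.
move=> FE; set q := Num.sqrt _.
have q2 : q ^+ 2 = 1 + be ^+ 2 by rewrite sqr_sqrtr // addr_ge0 ?sqr_ge0.
have q0 : 0 < q by rewrite sqrtr_gt0 ltr_pwDl ?sqr_ge0.
have qn0 : q != 0 by rewrite gt_eqF.
exists 0, (vec 0 1 0), (vec q^-1 0 (be / q)); split.
- by vsimp; ring.
- vsimp; transitivity ((1 + be ^+ 2) / q ^+ 2); first by field.
  by rewrite q2 divff // -q2 expf_eq0 /= gt_eqF.
- by vsimp; ring.
- move=> x /FE[hz _ _]; exists (x 0 i1, q * x 0 i0) => //.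
  by apply: eq_rV3; vsimp; rewrite ?hz; field.
rewrite -strips_area //; congr (leb2 R _).
have pE (p : R2 R) : (0 + p.1 *: vec 0 1 0 + p.2 *: vec q^-1 0 (be / q) : 'rV[R]_3) =
  vec (p.2 / q) p.1 (be * (p.2 / q)) by apply: eq_rV3; vsimp; ring.
apply/seteqP; split => p /=; rewrite pE.
  move/FE; rewrite /vec !mxE /= => -[_ h1 h2]; split => //.
by move=> [h1 h2]; apply/FE; rewrite /vec !mxE /=; split.
Qed.

(** * The wedge over the chain and its faces *)

Definition wnormal (i : nat) : 'rV[R]_3 :=
  match i with
  | 0 => vec (- al) 0 1
  | 1 => vec (- ga) 0 (- 1)
  | k.+2 => vec (kap k) (s k) 0
  end.

Definition woffset (i : nat) : R := if i is k.+2 then eoff k else 0.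

Definition wedge : set 'rV[R]_3 :=
  polyhedron (fun i : 'I_m.+2 => wnormal i) (fun i : 'I_m.+2 => woffset i).

Lemma wedgeE (x : 'rV[R]_3) : wedge x <-> [/\ x 0 i2 <= al * x 0 i0,
  - (ga * x 0 i0) <= x 0 i2 &
  forall k, (k < m)%N -> kap k * x 0 i0 + s k * x 0 i1 <= eoff k].
Proof.
split.
  move=> hx; split.
  - by have := hx (@Ordinal m.+2 0 isT); rewrite /= ; vsimp; lra.
  - by have := hx (@Ordinal m.+2 1 isT); rewrite /= ; vsimp; lra.
  - move=> k km; have km2 : (k.+2 < m.+2)%N by [].
    by have := hx (Ordinal km2); rewrite /= ; vsimp; lra.
move=> [h1 h2 h3] [[|[|k]] hk] /=; vsimp; try lra.
by have := h3 k hk; lra.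
Qed.

(** The two cap inequalities add up to [0 <= c x]; [al] or [ga] alone may be negative. *)
Lemma wedge_x_ge0 (x : 'rV[R]_3) : x 0 i2 <= al * x 0 i0 ->
  - (ga * x 0 i0) <= x 0 i2 -> 0 <= x 0 i0.
Proof. by move=> h1 h2; rewrite -(pmulr_rge0 _ c0) -cE mulrDl; lra. Qed.

Definition wface (i : 'I_m.+2) : set 'rV[R]_3 :=
  face_of (fun i : 'I_m.+2 => wnormal i) (fun i : 'I_m.+2 => woffset i) i.

Lemma wedge_interior : wedge° !=set0.
Proof.
have x1 : 0 < vtx 1 by apply: vtx_gt0; lia.
(* Halfway between the ridge [x = 0] and vertex [1], in the middle of the vertical segment between
   the caps. *)
exists (vec (vtx 1 / 2) (vty 1) ((al - ga) * vtx 1 / 4)).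
apply: interior_polyhedron => -[[|[|k]] hk] /=; vsimp.
- by have := mulr_gt0 c0 x1; rewrite -cE; lra.
- by have := mulr_gt0 c0 x1; rewrite -cE; lra.
have km : (k < m)%N by [].
have := vertex_le km (ltnW m2); have := mulr_gt0 (kap_gt0 km) x1; lra.
Qed.

Lemma wedge_bounded : bounded_set wedge.
Proof.
have m0 : (0 < m)%N by lia.
have k0 := kap_gt0 m0.
pose My := `|vty 0| + `|vty m|.
pose Mx := (`|eoff 0| + `|s 0| * My) / kap 0.
pose Mz := (`|al| + `|ga|) * Mx.
have My0 : 0 <= My by rewrite addr_ge0.
have Mx0 : 0 <= Mx.
  by apply: divr_ge0; [apply: addr_ge0 => //; apply: mulr_ge0|exact: ltW].
have Mz0 : 0 <= Mz by apply: mulr_ge0 => //; exact: addr_ge0.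
apply: (@bounded_set_coord _ _ (Mx + My + Mz)) => x /wedgeE[h1 h2 h3].
have x0 := wedge_x_ge0 h1 h2.
have /andP[y1 y2] := chain_bounds x0 h3.
have hy : `|x 0 i1| <= My.
  rewrite /My ler_norml; have := ler_norm (vty m); have := ler_norm (- vty 0);
    rewrite normrN.
  have := normr_ge0 (vty 0); have := normr_ge0 (vty m); lra.
have hx : x 0 i0 <= Mx.
  rewrite /Mx ler_pdivlMr //; have := h3 0%N m0.
  have := ler_norm (eoff 0); have := ler_norm (- (s 0 * x 0 i1)).
  rewrite normrN normrM; have := ler_wpM2l (normr_ge0 (s 0)) hy; lra.
have hz : `|x 0 i2| <= Mz.
  have e1 : al * x 0 i0 <= `|al| * Mx.
    apply: le_trans (ler_norm _) _; rewrite normrM (ger0_norm x0); exact: ler_wpM2l.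
  have e2 : ga * x 0 i0 <= `|ga| * Mx.
    apply: le_trans (ler_norm _) _; rewrite normrM (ger0_norm x0); exact: ler_wpM2l.
  have e3 : 0 <= `|al| * Mx by exact: mulr_ge0.
  have e4 : 0 <= `|ga| * Mx by exact: mulr_ge0.
  rewrite ler_norml /Mz mulrDl; lra.
by apply: ord3_ind; rewrite ?(ger0_norm x0); lra.
Qed.

Lemma wnormal_neq0 (i : 'I_m.+2) : wnormal i != 0.
Proof.
apply/eqP => /rowP; case: i => [[|[|k]] hk] /= E.
- by have := E i2; vsimp => /eqP; rewrite oner_eq0.
- by have := E i2; vsimp => /eqP; rewrite oppr_eq0 oner_eq0.
have km : (k < m)%N by [].
by have := E i0; vsimp => /eqP; rewrite gt_eqF // kap_gt0.
Qed.

Lemma wnormal_not_parallel (i j : nat) : (i < j)%N -> (j < m.+2)%N ->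
  cross (wnormal i) (wnormal j) != 0.
Proof.
case: i => [|[|k]]; case: j => [|[|l]] //= ij hj; apply/eqP => /rowP E.
- have := E i1; vsimp => /eqP; rewrite (_ : _ - _ = - c) ?oppr_eq0 ?(negbTE cn0) //.
  by rewrite -cE; ring.
- have := E i1; vsimp; have := @kap_gt0 l hj; lra.
- have := E i1; vsimp; have := @kap_gt0 l hj; lra.
- have := E i2; vsimp; have kl : (k < l)%N by [].
  by have := turn kl hj; lra.
Qed.

Lemma wface_cap0 : forall x, wface (@Ordinal m.+2 0 isT) x <->
  [/\ x 0 i2 = al * x 0 i0, 0 <= x 0 i0 &
     forall k, (k < m)%N -> kap k * x 0 i0 + s k * x 0 i1 <= eoff k].
Proof.
move=> x; split.
  move=> [/wedgeE[h1 h2 h3]]; rewrite /plane /=; vsimp => E; split => //; first lra.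
  exact: wedge_x_ge0 h1 h2.
move=> [E x0 h3]; split; last by rewrite /plane /=; vsimp; lra.
by apply/wedgeE; split => //; have := mulr_ge0 (ltW c0) x0; rewrite -cE mulrDl; lra.
Qed.

Lemma wface_cap1 : forall x, wface (@Ordinal m.+2 1 isT) x <->
  [/\ x 0 i2 = (- ga) * x 0 i0, 0 <= x 0 i0 &
     forall k, (k < m)%N -> kap k * x 0 i0 + s k * x 0 i1 <= eoff k].
Proof.
move=> x; split.
  move=> [/wedgeE[h1 h2 h3]]; rewrite /plane /=; vsimp => E; split => //; first lra.
  exact: wedge_x_ge0 h1 h2.
move=> [E x0 h3]; split; last by rewrite /plane /=; vsimp; lra.
by apply/wedgeE; split => //; have := mulr_ge0 (ltW c0) x0; rewrite -cE mulrDl; lra.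
Qed.

Lemma wface_side k (km : (k.+2 < m.+2)%N) (p z : R) :
  wface (Ordinal km) (vec (vtx k - s k * p) (vty k + kap k * p) z) <->
  0 <= p <= elen k /\ - (ga * (vtx k - s k * p)) <= z <= al * (vtx k - s k * p).
Proof.
have km' : (k < m)%N by [].
have k0 := kap_gt0 km'.
split.
  move=> [/wedgeE[h1 h2 h3] _]; have x0 := wedge_x_ge0 h1 h2.
  move: h1 h2 h3 x0; rewrite /vec !mxE /= => h1 h2 h3 x0; split; last by rewrite h1 h2.
  exact: (edge_bounds km' x0 h3).
move=> [/andP[p0 pL] /andP[z1 z2]]; split; last by rewrite /plane /=; vsimp;
  rewrite /eoff; ring.
apply/wedgeE; rewrite /vec !mxE /=; split => //.
apply: (strip_le km').
  by rewrite vtyS lerDl mulr_ge0 ?(ltW k0) //= lerD2l mulrC ler_pM2r.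
rewrite /eoff; lra.
Qed.

(** At first coordinate [x] the side has height [c x], so its area is [c * elen k] times the mean of
    [vtx k] and [vtx k.+1]. *)
Lemma side_area k (km : (k.+2 < m.+2)%N) : has_area (wface (Ordinal km)) (a k).
Proof.
have km' : (k < m)%N by [].
have k2 := kap_sqr km'; have k0 := kap_gt0 km'.
exists (vec (vtx k) (vty k) 0), (vec (- s k) (kap k) 0), (vec 0 0 1); split.
- by vsimp; transitivity (s k ^+ 2 + kap k ^+ 2); [ring|rewrite k2; ring].
- by vsimp; ring.
- by vsimp; ring.
- move=> x [_]; rewrite /plane /=; vsimp => E.
  exists ((x 0 i1 - vty k) / kap k, x 0 i2) => //.
  have x0E : x 0 i0 = vtx k - s k * ((x 0 i1 - vty k) / kap k).
    apply: (mulfI (_ : kap k != 0)); rewrite ?gt_eqF //.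
    have -> : kap k * x 0 i0 = eoff k - s k * x 0 i1 by lra.
    by rewrite /eoff; field; rewrite gt_eqF.
  apply: eq_rV3; vsimp; [rewrite x0E; ring|field; rewrite gt_eqF //|ring].
have le0 : ga * s k * 0 + - (ga * vtx k) <= - (al * s k) * 0 + al * vtx k.
  by have := mulr_ge0 (ltW c0) (vtx_ge0 k); rewrite -cE; lra.
have le1 : ga * s k * elen k + - (ga * vtx k) <= - (al * s k) * elen k + al * vtx k.
  have := mulr_ge0 (ltW c0) (vtx_ge0 k.+1); rewrite vtxS // -cE; lra.
have [_] := leb2_trapezoid true false (ltW (elen_gt0 km')) le0 le1.
rewrite (_ : (elen k - 0) * _ = a k); last first.
  have -> : (elen k - 0) * ((- (al * s k) - ga * s k) * (0 + elen k) / 2 +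
    (al * vtx k - - (ga * vtx k)))
    = (al + ga) * elen k * (vtx k + (vtx k - elen k * s k)) / 2 by field.
  rewrite -vtxS // cE /elen; have := vtxD_gt0 km' => xx; field.
  by rewrite cn0 gt_eqF.
move=> <-; congr (leb2 R _).
have pE (p : R2 R) : (vec (vtx k) (vty k) 0 + p.1 *: vec (- s k) (kap k) 0 +
  p.2 *: vec 0 0 1 : 'rV[R]_3) =
  vec (vtx k - s k * p.1) (vty k + kap k * p.1) p.2 by apply: eq_rV3; vsimp; ring.
apply/seteqP; split => p /=; rewrite pE in_itv /=.
  by move/wface_side => [h1 /andP[h2 h3]]; split => //; apply/andP; split; lra.
by move=> [h1 /andP[h2 h3]]; apply/wface_side; split => //; apply/andP; split; lra.
Qed.

Lemma wface_dim (i : 'I_m.+2) : has_affine_dim (wface i) 2.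
Proof.
have x1 : 0 < vtx 1 by apply: vtx_gt0; lia.
have m0 : (0 < m)%N by lia.
have y0m := vty_lt m0 (leqnn m).
have Fi : wface i `<=` plane (wnormal i) (woffset i) by move=> x [].
have cap (be : R) : (forall x, wface i x <-> [/\ x 0 i2 = be * x 0 i0, 0 <= x 0 i0 &
     forall k, (k < m)%N -> kap k * x 0 i0 + s k * x 0 i1 <= eoff k]) ->
   has_affine_dim (wface i) 2.
  move=> FE.
  (* The two ends of the ridge, where the caps meet, and the lift of vertex [1]. *)
  apply: (@has_affine_dim2 _ _ (wnormal i) (woffset i) (vec 0 (vty 0) 0) (vec 0 (vty m) 0)
    (vec (vtx 1) (vty 1) (be * vtx 1))) => //.
  - exact: wnormal_neq0.
  - apply/FE; rewrite /vec !mxE /=; split; rewrite ?mulr0 // => k km.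
    by have := vertex_le km (leq0n m); rewrite vtx0 mulr0.
  - apply/FE; rewrite /vec !mxE /=; split; rewrite ?mulr0 // => k km.
    by have := vertex_le km (leqnn m); rewrite vtxm mulr0.
  - apply/FE; rewrite /vec !mxE /=; split; rewrite ?(ltW x1) // => k km.
    by apply: vertex_le => //; exact: ltnW.
  apply/eqP => /rowP/(_ i2); vsimp => E.
  have := mulr_gt0 (_ : 0 < vty m - vty 0) x1; rewrite subr_gt0 => /(_ y0m); lra.
case: i Fi cap => [[|[|k]] hk] Fi cap.
- apply: (cap al); rewrite (bool_irrelevance hk isT); exact: wface_cap0.
- apply: (cap (- ga)); rewrite (bool_irrelevance hk isT); exact: wface_cap1.
have km : (k < m)%N by [].
have k0 := kap_gt0 km; have l0 := elen_gt0 km.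
(* Over the midpoint of the edge the side has positive height, even when it degenerates to a
   triangle at an end of the chain. *)
pose xm := (vtx k + vtx k.+1) / 2.
have xmE : vtx k - s k * (elen k / 2) = xm by rewrite /xm vtxS //; field.
have xm0 : 0 < xm by rewrite divr_gt0 // vtxD_gt0.
have cxm : 0 < (al + ga) * xm by rewrite cE mulr_gt0.
have lL : 0 <= elen k / 2 <= elen k by lra.
pose pt (p z : R) : 'rV[R]_3 := vec (vtx k - s k * p) (vty k + kap k * p) z.
apply: (@has_affine_dim2 _ _ _ _ (pt (elen k / 2) (al * xm)) (pt (elen k / 2) (- (ga * xm)))
   (pt 0 (al * vtx k)) (wnormal_neq0 _) Fi).
- by apply/wface_side; split => //; rewrite xmE lexx; lra.
- by apply/wface_side; split => //; rewrite xmE lexx; lra.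
- apply/wface_side; split; first lra.
  have := mulr_ge0 (ltW c0) (vtx_ge0 k); rewrite -cE mulr0 subr0 lexx; lra.
apply/eqP => /rowP/(_ i0); rewrite /pt; vsimp => E.
have := mulr_gt0 (mulr_gt0 cxm k0) l0; lra.
Qed.

Lemma wface_not_parallel_neq (i j : 'I_m.+2) : (i < j)%N -> wface i <> wface j.
Proof.
move=> ij E; have := wnormal_not_parallel ij (ltn_ord j).
rewrite (@affine_dim2_parallel _ (wface i) _ _ (woffset i) (woffset j)) ?eqxx //.
- exact: wface_dim.
- by move=> x [].
- by rewrite E => x [].
Qed.

Lemma wedge_nonflat : nonflat_polyhedron wface.
Proof.
exists wedge; split.
- split; first exact: wedge_bounded.
  by exists m.+2, (fun i : 'I_m.+2 => wnormal i), (fun i : 'I_m.+2 => woffset i).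
- exact: wedge_interior.
- move=> i j E; apply: val_inj; have [lt|lt|//] := ltngtP i j.
    by have := wface_not_parallel_neq lt; rewrite E.
  by have := wface_not_parallel_neq lt; rewrite E.
move=> G; split.
  by move=> /(facetE wedge_interior)[i _ ->]; exists i.
move=> [i ->]; apply: face_of_facet; first exact: wnormal_neq0.
exact: wface_dim.
Qed.

End Chain.

(** * Tilts of the caps and the final equivalence *)

(** In a triangle with sides [A1], [A2], [t], the altitude on [t] is [q], and its foot cuts [t] into
    the signed parts [p] and [t - p]; the law of cosines gives [p]. *)
Lemma triangle_height (R : realType) (A1 A2 t : R) : 0 < A2 -> A2 <= A1 ->
  A1 - A2 < t < A1 + A2 ->
  exists p q : R, [/\ 0 < q, A1 ^+ 2 = p ^+ 2 + q ^+ 2 & A2 ^+ 2 = (t - p) ^+ 2 + q ^+ 2].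
Proof.
move=> A20 A21 /andP[t1 t2]; have t0 : 0 < t by lra.
pose p := (A1 ^+ 2 - A2 ^+ 2 + t ^+ 2) / (2 * t).
have pE : 2 * t * p = A1 ^+ 2 - A2 ^+ 2 + t ^+ 2.
  by rewrite /p; field; rewrite gt_eqF.
have q2 : 0 < A1 ^+ 2 - p ^+ 2.
  have d : 0 < 2 * t by lra.
  have h1 : 0 < A1 - p.
    rewrite -(pmulr_rgt0 _ d) mulrBr pE.
    have -> : 2 * t * A1 - (A1 ^+ 2 - A2 ^+ 2 + t ^+ 2) =
      (A2 - (A1 - t)) * (A2 + (A1 - t)) by ring.
    by apply: mulr_gt0; lra.
  have h2 : 0 < A1 + p.
    rewrite -(pmulr_rgt0 _ d) mulrDr pE.
    have -> : 2 * t * A1 + (A1 ^+ 2 - A2 ^+ 2 + t ^+ 2) =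
      (A1 + t - A2) * (A1 + t + A2) by ring.
    by apply: mulr_gt0; lra.
  by rewrite subr_sqr mulr_gt0.
exists p, (Num.sqrt (A1 ^+ 2 - p ^+ 2)); rewrite sqrtr_gt0 sqr_sqrtr ?(ltW q2) //.
by split => //; rewrite ?sqrrB; lra.
Qed.

(** For [c = t / q] the base has area [t / c = q], so a cap of slope [p / q] has area
    [sqrt (p^2 + q^2)]. *)
Lemma sqrt_slope (R : realType) (A p q t : R) : 0 < A -> 0 < q -> 0 < t ->
  A ^+ 2 = p ^+ 2 + q ^+ 2 -> Num.sqrt (1 + (p / q) ^+ 2) * t / (t / q) = A.
Proof.
move=> A0 q0 t0 E; have -> : 1 + (p / q) ^+ 2 = (A / q) ^+ 2.
  by rewrite !expr_div_n E; field; rewrite gt_eqF.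
rewrite sqrtr_sqr gtr0_norm ?divr_gt0 //; field.
by rewrite !gt_eqF.
Qed.

(** Indices start at zero here: [A 0] and [A 1] go to the caps, the others to the sides. *)
Lemma nonflat_exists (R : realType) (m : nat) (A : nat -> R) : (2 <= m)%N ->
  (forall i, (i < m.+2)%N -> 0 < A i) -> (forall i, (i < m.+2)%N -> A i <= A 0%N) ->
  A 0%N < A 1%N + \sum_(0 <= k < m) A k.+2 ->
  exists F : 'I_m.+2 -> set 'rV[R]_3, nonflat_polyhedron F /\
    forall i : 'I_m.+2, has_area (F i) (A i).
Proof.
move=> m2 A0 AA AS.
have A00 := A0 0%N isT; have A10 := A0 1%N isT; have A01 := AA 1%N isT.
pose a k := A k.+2.
have a0 k : (k < m)%N -> 0 < a k by move=> km; exact: A0.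
have ahi k : (k < m)%N -> a k < A 0%N + A 1%N.
  by move=> km; have := AA k.+2 km; rewrite /a; lra.
have lohi : A 0%N - A 1%N < A 0%N + A 1%N by lra.
have loS : A 0%N - A 1%N < \sum_(k < m) a k by rewrite -(big_mkord xpredT a); lra.
have [s [s1 smon s0 ht]] := slopes_exist m2 a0 ahi lohi loS.
rewrite -(big_mkord xpredT (fun k => a k * s k)) in s0.
rewrite -(big_mkord xpredT (fun k => a k * kap s k)) in ht.
set t := \sum_(0 <= k < m) _ in ht.
have t0 : 0 < t by lra.
have [p [q [q0 E1 E2]]] := triangle_height A10 A01 ht.
(* The slopes [p / q] and [(t - p) / q] of the two caps add up to [c = t / q]. *)
have c0 : 0 < t / q by exact: divr_gt0.
have cE : p / q + (t - p) / q = t / q by rewrite -mulrDl; congr (_ / _); ring.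
exists (wface a s (t / q) (p / q) ((t - p) / q) (m := m)); split.
  exact: wedge_nonflat.
move=> [[|[|k]] hk] /=.
- rewrite (bool_irrelevance hk isT) -(sqrt_slope A00 q0 t0 E1).
  by apply: cap_area => //; exact: wface_cap0.
- rewrite (bool_irrelevance hk isT) -(sqrt_slope A10 q0 t0 E2) -sqrrN.
  by apply: cap_area => //; exact: wface_cap1.
- exact: side_area.
Qed.

Theorem theorem2 (R : realType) (n : nat) (A : nat -> R)
    (hn : (4 <= n)%N)
    (A_gt0 : forall i : nat, (1 <= i <= n)%N -> 0 < A i)
    (A_noninc : forall i : nat, (1 <= i <= n.-1)%N -> A i.+1 <= A i) :
  (exists F : 'I_n -> set 'rV[R]_3,
     (nonflat_polyhedron F \/
      (A 1%N = \sum_(2 <= i < n.+1) A i /\ flat_polyhedron F)) /\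
     forall i : 'I_n, has_area (F i) (A i.+1))
  <-> A 1%N <= \sum_(2 <= i < n.+1) A i.
Proof.
have n0 : (0 < n)%N by lia.
split.
  move=> [F [[nf|[-> _ //]] hA]].
  apply: le_trans (nonflat_area_le (A := fun i => A i.+1) (Ordinal n0) nf hA) _.
  suff -> : \sum_(j < n | j != Ordinal n0) A j.+1 = \sum_(2 <= i < n.+1) A i by [].
  apply: (@addrI _ (A 1%N)).
  rewrite -[RHS]big_ltn // big_add1 /= big_mkord.
  by rewrite [RHS](bigD1 (Ordinal n0)).
rewrite le_eqVlt => /predU1P[E|lt].
  have n2 : (2 <= n)%N by exact: leq_trans hn.
  have [F [fF hF]] := flat_exists n2 A_gt0 E.
  by exists F; split => //; right.
have [m m2 nE] : exists2 m, (2 <= m)%N & n = m.+2 by exists (n - 2)%N; lia.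
subst n.
have AA i : (i < m.+2)%N -> A i.+1 <= A 1%N.
  elim: i => // i IH im; apply: le_trans (IH (ltnW im)).
  by apply: A_noninc.
have AS : A 1%N < A 2%N + \sum_(0 <= k < m) A k.+3.
  move: lt; rewrite big_ltn //; congr (_ < _ + _).
  by rewrite -[3%N]add0n big_addn subnS subnS subn1 /=; apply: eq_bigr => i _;
    rewrite addn3.
have A0 i : (i < m.+2)%N -> 0 < A i.+1 by move=> im; exact: A_gt0.
have [F [nf hF]] := nonflat_exists m2 A0 AA AS.
by exists F; split => //; left.
Qed.
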